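(* There exists a strongly polynomial time algorithm which, given $A\in\mathbb{Z}^{m\times n}$ of full row rank, $b\in\mathbb{Z}^m$, and $u\in\mathbb{R}^n$ with $u>0$ (componentwise), in $O(n^4)$ arithmetic operations returns one of the following: 1. A feasible solution to the system $Ax=b$, $x\ge 0$; 2. A vector $(v,w)\in\mathbb{R}^m\times\mathbb{R}^n_+$, $w\neq 0$, such that $(v^\top A+w^\top)\bar x< v^\top b+\frac{1}{2n}w^\top u$ for every $\bar x\in \{x\in\mathbb{R}^n : 0\leq x\leq u\}$.
   Context: $\mathbb{R}^n_+$ denotes the set of componentwise nonnegative vectors in $\mathbb{R}^n$; vector inequalities are componentwise. ''Strongly polynomial'' means that the number of arithmetic operations is bounded by a polynomial in the dimensions only, and the encoding sizes of the numbers occurring in the computation remain polynomially bounded in the encoding size of the input. *)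

(* Defs.v *)
From HB Require Import structures.
From mathcomp Require Import all_boot all_order all_algebra.
From mathcomp Require Import reals.

Set Implicit Arguments.
Unset Strict Implicit.
Unset Printing Implicit Defensive.

Import Order.TTheory GRing.Theory Num.Theory.
Local Open Scope ring_scope.

(* The model of computation is a real random access machine, presented as a
   deterministic while language.  A program is a fixed finite object, the same
   for all dimensions, and it mentions no real number besides integer literals.
   There are two kinds of data:
   - counters (natural numbers), used for loop control and for addressing; they
     can only be set, copied, incremented and decremented, hence never exceed
     max(m, n) + (number of steps) + (a constant of the program);
   - numbers, stored in two-dimensional arrays with unbounded index range;
     vectors are stored in column 0.
   No instruction converts between the two kinds. *)

Inductive idx := ICst of nat | IVar of nat.

(* [Cell a i j] is the entry (i, j) of the array named a *)
Inductive cell := Cell of nat & idx & idx.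

Inductive arith_op := OpAdd | OpSub | OpMul | OpDiv.

Inductive test :=
  | CtrLt of idx & idx
  | NumLe of cell & cell.

Inductive program :=
  | Skip
  | Seq of program & program
  | SetCtr of nat & idx
  | IncrCtr of nat
  | DecrCtr of nat
  | SetNum of cell & int
  | CopyNum of cell & cell
  | Arith of cell & arith_op & cell & cell
  | If of test & program & program
  | While of test & program.

Section Semantics.
Variable R : realType.

Record state := State { ctr : nat -> nat; mem : nat -> nat -> nat -> R }.

Definition ieval (s : state) (e : idx) : nat :=
  match e with ICst k => k | IVar x => ctr s x end.

Definition get (s : state) (c : cell) : R :=
  let: Cell a i j := c in mem s a (ieval s i) (ieval s j).

Definition put_ctr (s : state) (x k : nat) : state :=
  State (fun y => if y == x then k else ctr s y) (mem s).

Definition put (s : state) (c : cell) (r : R) : state :=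
  let: Cell a i j := c in
  State (ctr s) (fun a' i' j' =>
    if [&& a' == a, i' == ieval s i & j' == ieval s j] then r
    else mem s a' i' j').

Definition arith_eval (o : arith_op) (x y : R) : R :=
  match o with
  | OpAdd => x + y | OpSub => x - y | OpMul => x * y | OpDiv => x / y
  end.

Definition holds (s : state) (t : test) : bool :=
  match t with
  | CtrLt i j => (ieval s i < ieval s j)%N
  | NumLe c d => get s c <= get s d
  end.

(* One event per executed instruction: an arithmetic operation on numbers with
   its result, a comparison of numbers, or anything else (counters, moves). *)
Inductive event := EArith of R | ECompare | EOther.

Definition test_event (t : test) : event :=
  match t with CtrLt _ _ => EOther | NumLe _ _ => ECompare end.

(* [exec P s tr s'] : started in s, P halts in s' after the events tr.
   Division by zero has no rule: a program attempting it does not halt. *)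
Inductive exec : program -> state -> seq event -> state -> Prop :=
  | ExecSkip s : exec Skip s [::] s
  | ExecSeq P Q s s1 s2 tr1 tr2 :
      exec P s tr1 s1 -> exec Q s1 tr2 s2 ->
      exec (Seq P Q) s (tr1 ++ tr2) s2
  | ExecSetCtr x e s :
      exec (SetCtr x e) s [:: EOther] (put_ctr s x (ieval s e))
  | ExecIncrCtr x s : exec (IncrCtr x) s [:: EOther] (put_ctr s x (ctr s x).+1)
  | ExecDecrCtr x s : exec (DecrCtr x) s [:: EOther] (put_ctr s x (ctr s x).-1)
  | ExecSetNum c z s : exec (SetNum c z) s [:: EOther] (put s c z%:~R)
  | ExecCopyNum c d s : exec (CopyNum c d) s [:: EOther] (put s c (get s d))
  | ExecArith c o d e s r :
      (o = OpDiv -> get s e != 0) ->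
      r = arith_eval o (get s d) (get s e) ->
      exec (Arith c o d e) s [:: EArith r] (put s c r)
  | ExecIfTrue t P Q s s1 tr :
      holds s t -> exec P s tr s1 -> exec (If t P Q) s (test_event t :: tr) s1
  | ExecIfFalse t P Q s s1 tr :
      ~~ holds s t -> exec Q s tr s1 ->
      exec (If t P Q) s (test_event t :: tr) s1
  | ExecWhileFalse t P s :
      ~~ holds s t -> exec (While t P) s [:: test_event t] s
  | ExecWhileTrue t P s s1 s2 tr1 tr2 :
      holds s t -> exec P s tr1 s1 -> exec (While t P) s1 tr2 s2 ->
      exec (While t P) s (test_event t :: tr1 ++ tr2) s2.

Definition num_steps (tr : seq event) : nat := size tr.

Definition num_arith (tr : seq event) : nat :=
  count (fun e => if e is EOther then false else true) tr.

Lemma exec_det P s tr1 s1 tr2 s2 :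
  exec P s tr1 s1 -> exec P s tr2 s2 -> tr1 = tr2 /\ s1 = s2.
Proof.
move=> E1; elim: E1 tr2 s2 => {P s tr1 s1}; intros;
  match goal with H : exec _ _ ?t ?z |- _ = ?t /\ _ = ?z =>
    inversion H; subst => // end;
  repeat match goal with
  | h : is_true (~~ holds ?s ?t), h' : is_true (holds ?s ?t) |- _ =>
      by rewrite h' in h
  | IH : (forall _ _, exec ?P ?s _ _ -> _), H : exec ?P ?s _ _ |- _ =>
      case: (IH _ _ H) => ? ?; subst; clear IH
  end; by [].
Qed.

(* The numbers produced by arithmetic operations.  Every number in memory during
   a run is one of these, an input, or one of the integer literals of the
   program. *)
Definition computed (tr : seq event) : seq R :=
  pmap (fun e => if e is EArith r then Some r else None) tr.

(* Entries outside the matrix are 0. *)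
Definition store_mx m n (M : 'M[R]_(m, n)) (i j : nat) : R :=
  match insub i, insub j with
  | Some i', Some j' => M i' j'
  | _, _ => 0
  end.

Definition load_mx m n (f : nat -> nat -> R) : 'M[R]_(m, n) :=
  \matrix_(i < m, j < n) f i j.

(* Input convention: counters 0, 1 hold m, n; arrays 0, 1, 2 hold A, b, u;
   everything else is 0. *)
Definition input m n (A : 'M[int]_(m, n)) (b : 'cV[int]_m) (u : 'cV[R]_n) :
    state :=
  State
    (fun x => match x with 0%N => m | 1%N => n | _ => 0%N end)
    (fun a => match a with
       | 0%N => store_mx (map_mx intr A)
       | 1%N => store_mx (map_mx intr b)
       | 2%N => store_mx u
       | _ => fun _ _ => 0
       end).

Inductive outcome m n :=
  | Solution of 'cV[R]_n
  | Certificate of 'cV[R]_m & 'cV[R]_n.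

(* Output convention: if counter 2 holds 0, then array 3 holds x; otherwise
   arrays 4, 5 hold v, w. *)
Definition output m n (s : state) : outcome m n :=
  if ctr s 2 == 0%N then Solution m (load_mx n 1 (mem s 3))
  else Certificate (load_mx m 1 (mem s 4)) (load_mx n 1 (mem s 5)).

Definition valid_outcome m n (A : 'M[int]_(m, n)) (b : 'cV[int]_m)
    (u : 'cV[R]_n) (o : outcome m n) : Prop :=
  let AR : 'M[R]_(m, n) := map_mx intr A in
  let bR : 'cV[R]_m := map_mx intr b in
  match o with
  | Solution x => AR *m x = bR /\ (forall i, 0 <= x i 0)
  | Certificate v w =>
      [/\ forall i, 0 <= w i 0,
          w != 0
        & forall xbar : 'cV[R]_n,
            (forall i, 0 <= xbar i 0 <= u i 0) ->
            ((v^T *m AR + w^T) *m xbar) 0 0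
              < (v^T *m bR) 0 0 + 1 / (2 * n%:R) * (w^T *m u) 0 0]
  end.

End Semantics.

(* Binary encoding sizes: 1 + ceil(log2(|p|+1)) + ceil(log2(q+1)) for p/q in
   lowest terms, and mn plus the sizes of the entries for an m x n matrix. *)
Definition rat_size (r : rat) : nat :=
  (1 + up_log 2 (`|numq r|%N + 1) + up_log 2 (`|denq r|%N + 1))%N.

Definition mx_size m n (M : 'M[rat]_(m, n)) : nat :=
  (m * n + \sum_(i < m) \sum_(j < n) rat_size (M i j))%N.

Definition input_size m n (A : 'M[int]_(m, n)) (b : 'cV[int]_m)
    (u : 'cV[rat]_n) : nat :=
  (mx_size (map_mx intr A) + mx_size (map_mx intr b) + mx_size u)%N.

(* Main.v *)
Require Import Defs.
From HB Require Import structures.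
From mathcomp Require Import all_boot all_order all_algebra.
From mathcomp Require Import reals.
From mathcomp Require Import perm zify ring lra.
(* Imported again so that [mem] denotes the memory of a [state] and not the
   membership operation of ssrbool. *)
Require Import Defs.

Set Implicit Arguments.
Unset Strict Implicit.
Unset Printing Implicit Defensive.

Import Order.TTheory GRing.Theory Num.Theory.
Local Open Scope ring_scope.

(* Substituting x = diag(u) y and homogenizing with a variable t, the system
   becomes B (y, t) = 0 with B = [A diag(u) | -b]; the coordinate t is stored
   last.  Rank-one updates along the rows of B (Gram-Schmidt) produce the
   orthogonal projection P onto ker B together with V such that P = 1 + B^T V.
   By Cramer's rule on the Gram matrices of the first i rows, every intermediate
   P and V has entries of polynomial size.
   A perceptron then maintains integer weights z >= 0, z <> 0, and p = P z,
   v = V z.  If p >= 0 and p_t > 0, then x = u p / p_t is feasible.  Otherwise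
   some k has p_k <= 0, and incrementing z_k raises |p|^2 by at most 1; integer
   weights (in place of a line search) keep the numbers small.  After 8 n^3
   increments |p|^2 <= K := sum z = 8 n^3 + 1.  As B^T v = p - z, the pair
   (v, z / u) violates the certificate inequality only if p has inner product
   at least K / (2 n) with some vector of [0, 1]^(n+1), which is excluded by
   Cauchy-Schwarz because K > 4 n^2 (n + 1). *)

(** * Program logic *)

Fixpoint wctr (P : program) : seq nat :=
  match P with
  | Seq P Q | If _ P Q => wctr P ++ wctr Q
  | SetCtr x _ | IncrCtr x | DecrCtr x => [:: x]
  | While _ P => wctr P
  | _ => [::]
  end.

Definition cell_array (c : cell) : nat := let: Cell a _ _ := c in a.

Fixpoint wmem (P : program) : seq nat :=
  match P with
  | Seq P Q | If _ P Q => wmem P ++ wmem Q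
  | SetNum c _ | CopyNum c _ | Arith c _ _ _ => [:: cell_array c]
  | While _ P => wmem P
  | _ => [::]
  end.

Definition for_loop (x : nat) (e : idx) (body : program) : program :=
  Seq (SetCtr x (ICst 0)) (While (CtrLt (IVar x) e) (Seq body (IncrCtr x))).

Definition idx_fresh (e : idx) (xs : seq nat) : bool :=
  if e is IVar y then y \notin xs else true.

Section ProgramLogic.
Variable R : realType.
Implicit Types (s : state R) (P Q : program) (Z : R -> Prop).

(* Data that P never writes is preserved; the write sets are syntactic, so that
   preservation is decided by computation. *)
Definition frame P s s' : Prop :=
  (forall x, x \notin wctr P -> ctr s' x = ctr s x) /\
  (forall a, a \notin wmem P -> mem s' a = mem s a).

Lemma exec_frame P s tr s' : exec P s tr s' -> frame P s s'.
Proof.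
elim=> {P s tr s'} /=.
- by [].
- move=> P Q s s1 s2 _ _ _ [c1 m1] _ [c2 m2]; split=> x;
    rewrite mem_cat negb_or => /andP[xP xQ]; first by rewrite c2 // c1.
  by rewrite m2 // m1.
- by move=> x e s; split=> // y; rewrite /= inE => /negbTE->.
- by move=> x s; split=> // y; rewrite /= inE => /negbTE->.
- by move=> x s; split=> // y; rewrite /= inE => /negbTE->.
- by move=> [a i j] z s; split=> // y; rewrite /= inE => /negbTE->.
- by move=> [a i j] d s; split=> // y; rewrite /= inE => /negbTE->.
- by move=> [a i j] o d e s r _ _; split=> // y; rewrite /= inE => /negbTE->.
- move=> t P Q s s1 tr _ _ [c1 m1]; split=> x;
    by rewrite mem_cat negb_or => /andP[xP xQ]; rewrite ?c1 ?m1.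
- move=> t P Q s s1 tr _ _ [c1 m1]; split=> x;
    by rewrite mem_cat negb_or => /andP[xP xQ]; rewrite ?c1 ?m1.
- by [].
- move=> t P s s1 s2 tr1 tr2 _ _ [c1 m1] _ [c2 m2]; split=> x xP.
    by rewrite c2 // c1.
  by rewrite m2 // m1.
Qed.

(** Total correctness with two cost budgets. The predicate [Z] stays abstract, so the size bound on
    computed numbers is proved in the same pass as functional correctness. *)
Definition runs Z P s (a t : nat) (Q : state R -> Prop) : Prop :=
  exists tr s', [/\ exec P s tr s', (num_arith tr <= a)%N, (num_steps tr <= t)%N,
    forall x, x \in computed tr -> Z x & Q s'].

Lemma runs_weaken Z P s a t a' t' (Q Q' : state R -> Prop) :
  runs Z P s a t Q -> (a <= a')%N -> (t <= t')%N ->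
  (forall s', frame P s s' -> Q s' -> Q' s') -> runs Z P s a' t' Q'.
Proof.
move=> [tr [s' [ex ha ht hz hq]]] haa htt hQ; exists tr, s'; split=> //.
- exact: leq_trans haa.
- exact: leq_trans htt.
- by apply: hQ => //; apply: exec_frame ex.
Qed.

Lemma runs_post Z P s a t (Q Q' : state R -> Prop) :
  runs Z P s a t Q -> (forall s', frame P s s' -> Q s' -> Q' s') ->
  runs Z P s a t Q'.
Proof. by move=> H; apply: (runs_weaken H). Qed.

Lemma runs_skip Z s (Q : state R -> Prop) : Q s -> runs Z Skip s 0 0 Q.
Proof. by move=> q; exists [::], s; split=> //; exact: ExecSkip. Qed.

Lemma runs_seq Z P P' s a t a' t' (Q : state R -> Prop) :
  runs Z P s a t (fun s1 => runs Z P' s1 a' t' Q) ->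
  runs Z (Seq P P') s (a + a') (t + t') Q.
Proof.
move=> [tr [s1 [ex ha ht hz [tr' [s2 [ex' ha' ht' hz' q]]]]]].
exists (tr ++ tr'), s2; split=> //.
- exact: ExecSeq ex ex'.
- by rewrite /num_arith count_cat leq_add.
- by rewrite /num_steps size_cat leq_add.
- move=> x; rewrite /computed pmap_cat mem_cat => /orP[]; [exact: hz|exact: hz'].
Qed.

Lemma runs_setctr Z x e s (Q : state R -> Prop) :
  Q (put_ctr s x (ieval s e)) -> runs Z (SetCtr x e) s 0 1 Q.
Proof. by move=> q; exists [:: EOther R], (put_ctr s x (ieval s e)); split=> //; exact: ExecSetCtr. Qed.

Lemma runs_incrctr Z x s (Q : state R -> Prop) :
  Q (put_ctr s x (ctr s x).+1) -> runs Z (IncrCtr x) s 0 1 Q.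
Proof. by move=> q; exists [:: EOther R], (put_ctr s x (ctr s x).+1); split=> //; exact: ExecIncrCtr. Qed.

Lemma runs_setnum Z c z s (Q : state R -> Prop) :
  Q (put s c z%:~R) -> runs Z (SetNum c z) s 0 1 Q.
Proof. by move=> q; exists [:: EOther R], (put s c z%:~R); split=> //; exact: ExecSetNum. Qed.

Lemma runs_arith Z c o d e s (Q : state R -> Prop) :
  (o = OpDiv -> get s e != 0) -> Z (arith_eval o (get s d) (get s e)) ->
  Q (put s c (arith_eval o (get s d) (get s e))) ->
  runs Z (Arith c o d e) s 1 1 Q.
Proof.
move=> nz z q; exists [:: EArith (arith_eval o (get s d) (get s e))].
eexists; split=> //; first exact: ExecArith.
  by move=> x; rewrite inE => /eqP->.
by [].
Qed.

Definition test_cost (t : test) : nat := if t is NumLe _ _ then 1%N else 0%N.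

Lemma runs_if Z t P P' s a k (Q : state R -> Prop) :
  (holds s t -> runs Z P s a k Q) -> (~~ holds s t -> runs Z P' s a k Q) ->
  runs Z (If t P P') s (test_cost t + a) k.+1 Q.
Proof.
move=> ht hf; have [h|h] := boolP (holds s t).
- have [tr [s1 [ex ha hk hz q]]] := ht h.
  exists (test_event R t :: tr), s1; split=> //; first exact: ExecIfTrue.
    by rewrite /num_arith /=; case: (t) => ? ? /=; rewrite ?add0n ?add1n.
  by case: (t) hz.
- have [tr [s1 [ex ha hk hz q]]] := hf h.
  exists (test_event R t :: tr), s1; split=> //; first exact: ExecIfFalse.
    by rewrite /num_arith /=; case: (t) => ? ? /=; rewrite ?add0n ?add1n.
  by case: (t) hz.
Qed.

(** [Inv k] describes the loop head when [x] holds k. The step also receives the frame from the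
    initial state, so data the loop never writes need not appear in the invariant. Each pass pays 2
    extra steps for test and increment; the last 2 are the initialization and the failing test. *)
Lemma runs_for Z x e body s N a t (Inv : nat -> state R -> Prop) :
  ieval s e = N -> x \notin wctr body -> idx_fresh e (x :: wctr body) ->
  Inv 0 (put_ctr s x 0) ->
  (forall k s', (k < N)%N -> ctr s' x = k -> frame (for_loop x e body) s s' ->
     Inv k s' -> runs Z body s' a t (fun s'' => Inv k.+1 (put_ctr s'' x k.+1))) ->
  runs Z (for_loop x e body) s (N * a) (N * (t + 2) + 2) (Inv N).
Proof.
move=> eN xb efr I0 step.
apply: (@runs_weaken _ _ _ (0 + N * a) (1 + (N * (t + 2) + 1)) _ _ (Inv N)) => //; last by lia.
apply: runs_seq; apply: runs_setctr => /=.
have eE s0 : frame (for_loop x e body) s s0 -> ieval s0 e = N.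
  rewrite -eN; case: (e) efr => //= y yx [f _]; rewrite f //= inE.
  by move: yx; rewrite !inE !negb_or mem_cat inE negb_or => /andP[-> ->]; rewrite ?andbT.
(* Induction on the number d of remaining passes, for an arbitrary current state. *)
suff gen : forall d k s0, (k + d = N)%N -> frame (for_loop x e body) s s0 ->
    Inv k s0 -> ctr s0 x = k ->
    runs Z (While (CtrLt (IVar x) e) (Seq body (IncrCtr x))) s0
      (d * a) (d * (t + 2) + 1) (Inv N).
  apply: (gen N 0%N); rewrite //= ?eqxx //.
  by split=> //= y; rewrite inE negb_or => /andP[/negbTE->].
elim=> [|d IH] k s0 dE fr0 Ik c0.
  have kE : N = k by lia.
  exists [:: EOther R], s0; split=> //; last by rewrite kE.
  apply: (@ExecWhileFalse _ (CtrLt (IVar x) e)) => /=.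
  by rewrite eE // c0 kE ltnn.
have kltN : (k < N)%N by lia.
have [tr [s1 [ex ha hs hz q]]] := step k s0 kltN c0 fr0 Ik.
have [fc1 fm1] := exec_frame ex.
have c1 : ctr s1 x = k by rewrite fc1.
have fr2 : frame (for_loop x e body) s (put_ctr s1 x k.+1).
  case: fr0 => f1 f2; split=> y /=.
    rewrite inE mem_cat inE !negb_or => /and3P[yx yb _]; rewrite (negbTE yx).
    by rewrite fc1 // f1 //= inE mem_cat inE !negb_or yx yb.
  by rewrite cats0 => yb; rewrite fm1 // f2 //= cats0.
have [] := IH k.+1 (put_ctr s1 x k.+1) _ fr2 q; [lia|by rewrite /= eqxx|].
move=> tr2 [s2 [ex2 ha2 hs2 hz2 q2]].
exists (EOther R :: (tr ++ [:: EOther R]) ++ tr2), s2; split=> //.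
- rewrite -[X in X :: (_ ++ _)]/(test_event R (CtrLt (IVar x) e)).
  apply: ExecWhileTrue ex2 => /=.
  + by rewrite eE // c0.
  + by have := ExecIncrCtr x s1; rewrite c1; apply: (ExecSeq ex).
- rewrite /num_arith -cat1s !count_cat /= mulSn; move: ha ha2; rewrite /num_arith; lia.
- rewrite /num_steps /= !size_cat /= in hs2 *; rewrite mulSn.
  by move: hs hs2; rewrite /num_steps; lia.
- move=> y; rewrite /computed /= !pmap_cat !mem_cat /= in_nil orbF => /orP[]; [exact: hz|exact: hz2].
Qed.

(** Nested loops serve as a product of iteration counts: one pass advances the invariant by [Nb].
    The cap [J] lets the body be specified only within the total number of iterations. *)
Lemma runs_for_mul Z x e body N Nb J a t (Inv : nat -> state R -> Prop) :
  (forall j s, Inv j s -> ieval s e = N) ->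
  (forall j s k, Inv j s -> Inv j (put_ctr s x k)) ->
  x \notin wctr body -> idx_fresh e (x :: wctr body) ->
  (forall j s, (j + Nb <= J)%N -> Inv j s -> runs Z body s a t (Inv (j + Nb)%N)) ->
  forall j s, (j + N * Nb <= J)%N -> Inv j s ->
  runs Z (for_loop x e body) s (N * a) (N * (t + 2) + 2) (Inv (j + N * Nb)%N).
Proof.
move=> Ie Ix xb efr step j s jJ Ij.
apply: (@runs_for Z x e body s N a t (fun k => Inv (j + k * Nb)%N)) => //.
- exact: Ie Ij.
- by rewrite addn0; apply: Ix.
- move=> k s' kN _ _ Ik; apply: runs_post (step _ _ _ Ik) _.
    apply: leq_trans jJ; rewrite -addnA leq_add2l addnC -mulSn leq_mul2r kN orbT //.
  by move=> s'' _; rewrite mulSn [(Nb + _)%N]addnC addnA => /Ix.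
Qed.

End ProgramLogic.

(** * Projection onto the kernel by rank-one updates *)

Section GramSchmidt.
Variables (F : realFieldType) (m N : nat) (B : 'M[F]_(m, N)).

(** These clauses characterize P as the orthogonal projection onto the complement of the first i
    rows; V holds the coefficients of the columns of P - 1 in those rows. *)
Definition gs_inv i (P : 'M[F]_N) (V : 'M[F]_(m, N)) : Prop :=
  [/\ P^T = P, P = 1%:M + B^T *m V,
      forall k : 'I_m, (i <= k)%N -> row k V = 0
    & forall k : 'I_m, (k < i)%N -> row k B *m P = 0].

Lemma gs_inv0 : gs_inv 0 1%:M 0.
Proof. by split=> [||k _|//]; rewrite ?trmx1 ?mulmx0 ?addr0 ?row0. Qed.

Lemma sumsq_row_eq0 (x : 'rV[F]_N) : (x *m x^T) 0 0 = 0 -> x = 0.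
Proof.
rewrite mxE => /eqP; rewrite psumr_eq0 => [/allP h|j _]; last first.
  by rewrite mxE -expr2 sqr_ge0.
apply/rowP => j; have := h j (mem_index_enum _); rewrite mxE mulf_eq0 orbb => /eqP->.
by rewrite mxE.
Qed.

(** P P = P + (B P)^T V, and the last product vanishes term by term: row k of B P is zero for k < i,
    row k of V is zero for k >= i. *)
Lemma gs_idem i P V : gs_inv i P V -> P *m P = P.
Proof.
move=> [sP eP V0 BP].
rewrite {2}eP mulmxDr mulmx1 mulmxA -[X in X *m B^T]sP -trmx_mul.
suff -> : (B *m P)^T *m V = 0 by rewrite addr0.
apply/matrixP=> a b; rewrite !mxE big1 // => k _.
have [ki|ik] := ltnP k i.
  have : row k (B *m P) = 0 by rewrite row_mul BP.
  by move=> /rowP/(_ a); rewrite mxE [RHS]mxE => h; rewrite mxE h mul0r.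
by have /rowP/(_ b) := V0 k ik; rewrite mxE [RHS]mxE => ->; rewrite mulr0.
Qed.

(** With b the row i of B, the pivot is |b P|^2. If it vanished, then (e_i + b V^T) B = b P = 0, so
    e_i + b V^T = 0 by freeness; but its coordinate i is 1, because row i of V is still zero. *)
Lemma gs_pivot (i : 'I_m) P V : row_free B -> gs_inv i P V ->
  (row i B *m P *m (row i B)^T) 0 0 != 0.
Proof.
move=> fB inv; have [sP eP V0 _] := inv; apply/eqP=> h.
have rP0 : row i B *m P = 0.
  apply: sumsq_row_eq0; rewrite trmx_mul sP mulmxA.
  by rewrite -[row i B *m P *m P]mulmxA (gs_idem inv).
have: delta_mx 0 i + row i B *m V^T = 0.
  apply/eqP; rewrite -(mulmx_free_eq0 _ fB) mulmxDl -rowE -mulmxA -{1}[row i B]mulmx1.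
  by rewrite -mulmxDr -[V^T *m B]trmxK trmx_mul trmxK -[X in X + _]trmx1 -linearD /= -eP sP rP0.
move=> /rowP/(_ i); rewrite !mxE !eqxx big1 ?addr0 => [/eqP|k _]; first by rewrite oner_eq0.
by have /rowP/(_ k) := V0 i (leqnn i); rewrite !mxE => ->; rewrite mulr0.
Qed.

Definition gs_col (i : 'I_m) (P : 'M[F]_N) : 'cV[F]_N := P *m (row i B)^T.
Definition gs_mult (i : 'I_m) (V : 'M[F]_(m, N)) : 'cV[F]_m :=
  V *m (row i B)^T + delta_mx i 0.
Definition gs_dual (i : 'I_m) (P : 'M[F]_N) : 'rV[F]_N :=
  ((row i B *m gs_col i P) 0 0)^-1 *: (gs_col i P)^T.

(** Writing q = P b^T = B^T (V b^T + e_i) = B^T y shows that subtracting y q^T / delta from V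
    matches subtracting q q^T / delta from P. The new P kills b because b q = delta, and still kills
    earlier rows because they are orthogonal to q. *)
Lemma gs_step (i : 'I_m) P V : row_free B -> gs_inv i P V ->
  gs_inv i.+1 (P - gs_col i P *m gs_dual i P) (V - gs_mult i V *m gs_dual i P).
Proof.
move=> fB inv; have [sP eP V0 BP] := inv; have := gs_pivot fB inv.
rewrite /gs_dual /gs_mult -mulmxA -/(gs_col i P).
set q := gs_col i P; set d := (_ 0 0) => d0.
have qT : q^T = row i B *m P by rewrite /q trmx_mul trmxK sP.
split.
- by rewrite linearB /= trmx_mul linearZ /= trmxK sP -scalemxAl -scalemxAr.
- rewrite {1}eP mulmxBr addrA; congr (_ + _ - _).
  rewrite mulmxA; congr (_ *m _); rewrite /q /gs_col eP mulmxDl mul1mx mulmxDr mulmxA addrC.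
  congr (_ + _); apply/colP=> j; rewrite !mxE (bigD1 i) //= !mxE !eqxx mulr1 big1 ?addr0 // => k ki.
  by rewrite !mxE (negbTE ki) mulr0.
- move=> k ik; have V0k := V0 k (ltnW ik); rewrite linearB /= V0k sub0r row_mul.
  suff -> : row k (V *m (row i B)^T + delta_mx i 0) = 0 by rewrite mul0mx oppr0.
  rewrite linearD /= row_mul V0k mul0mx add0r; apply/rowP=> j; rewrite !mxE.
  by case: eqP ik => // ->; rewrite ltnn.
- move=> k; rewrite ltnS leq_eqVlt mulmxBr mulmxA => /orP[/eqP/val_inj->|ki].
    rewrite -qT; apply/eqP; rewrite subr_eq0; apply/eqP.
    rewrite [row i B *m q]mx11_scalar mul_scalar_mx -/d scalerA divff // scale1r //.
  by rewrite /q /gs_col mulmxA BP // !mul0mx subrr.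
Qed.

End GramSchmidt.

(** * Sizes of rational numbers *)

Section IntegerBounds.
Local Open Scope nat_scope.

Lemma absz_sum_le (T : finType) (f : T -> int) c :
  (forall i, `|f i| <= c) -> `|(\sum_i f i)%R| <= #|T| * c.
Proof.
move=> fc; rewrite -lez_nat abszE; apply: le_trans (ler_norm_sum _ _ _) _.
have -> : (#|T| * c)%N = (\sum_(i : T) c%:Z)%R :> int.
  by rewrite sumr_const -mulr_natr natz mulrC.
by apply: ler_sum => i _; rewrite -abszE lez_nat.
Qed.

Lemma absz_prod (T : finType) (f : T -> int) :
  `|(\prod_i f i)%R| = \prod_i `|f i|.
Proof. by apply: (big_morph absz) => // x y; rewrite abszM. Qed.

Lemma leq_exp2 k : k <= 2 ^ k.
Proof. exact: ltnW (ltn_expl _ _). Qed.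

Lemma fact_le_exp k : k`! <= 2 ^ (k * k).
Proof.
case: k => // k; rewrite expnM.
suff : k.+1`! <= k.+1 ^ k.+1.
  by move/leq_trans; apply; rewrite leq_exp2r //; exact: leq_exp2.
move: k.+1 => {}k; elim: k => // k IH; rewrite factS expnS leq_mul2l /=.
apply: leq_trans IH _; case: k => // k; rewrite leq_exp2r //.
Qed.

(** Leibniz expansion: at most 2 ^ (k * k) permutations, each contributing a product of k
    entries. *)
Lemma det_bound k (M : 'M[int]_k) b :
  (forall i j, `|M i j| <= 2 ^ b) -> `|(\det M)%R| <= 2 ^ (k * k + k * b).
Proof.
move=> Mb; rewrite /determinant.
apply: leq_trans (absz_sum_le (c := 2 ^ (k * b)) _) _.
  move=> s; rewrite abszM abszX /= exp1n mul1n absz_prod.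
  apply: leq_trans (_ : \prod_(i < k) 2 ^ b <= _); first exact: leq_prod.
  by rewrite prod_nat_const card_ord -expnM mulnC.
have -> : #|{perm 'I_k}| = k`! by rewrite -card_Sn; apply: eq_card => s; rewrite inE.
by rewrite expnD leq_mul2r fact_le_exp orbT.
Qed.

Lemma adj_bound k (M : 'M[int]_k) b i j :
  (forall i j, `|M i j| <= 2 ^ b) -> `|(\adj M)%R i j| <= 2 ^ (k * k + k * b).
Proof.
move=> Mb; rewrite mxE /cofactor abszM abszX /= exp1n mul1n.
apply: leq_trans (det_bound (b := b) _) _; first by move=> ? ?; rewrite !mxE.
by rewrite leq_exp2l // leq_add ?leq_mul // leq_pred.
Qed.

End IntegerBounds.

Section Height.
Variable F : realFieldType.
Implicit Types x y : F.

Definition ht (h : nat) x : Prop :=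
  exists p q : int, [/\ q != 0, (`|p| <= 2 ^ h)%N, (`|q| <= 2 ^ h)%N &
    x = p%:~R / q%:~R].

Lemma ht_le h h' x : (h <= h')%N -> ht h x -> ht h' x.
Proof.
move=> hh [p [q [q0 hp hq ->]]]; exists p, q; split=> //.
  by apply: leq_trans hp _; rewrite leq_exp2l.
by apply: leq_trans hq _; rewrite leq_exp2l.
Qed.

Lemma ht_frac h p q : q != 0 -> (`|p| <= 2 ^ h)%N -> (`|q| <= 2 ^ h)%N ->
  ht h (p%:~R / q%:~R).
Proof. by move=> *; exists p, q. Qed.

Lemma ht_int h (z : int) : (`|z| <= 2 ^ h)%N -> ht h z%:~R.
Proof. by move=> hz; exists z, 1; rewrite divr1 expn_gt0. Qed.

Lemma ht0 h : ht h 0.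
Proof. exact: (@ht_int h 0). Qed.

Lemma ht1 h : ht h 1.
Proof. by apply: (@ht_int h 1); rewrite expn_gt0. Qed.

Lemma htM h h' x y : ht h x -> ht h' y -> ht (h + h') (x * y).
Proof.
move=> [p [q [q0 hp hq ->]]] [p' [q' [q0' hp' hq' ->]]].
exists (p * p'), (q * q'); rewrite mulf_neq0 // !abszM !expnD !leq_mul //; split=> //.
by rewrite !intrM invfM mulrACA.
Qed.

Lemma htV h x : ht h x -> ht h x^-1.
Proof.
move=> [p [q [q0 hp hq ->]]]; have [->|p0] := eqVneq p 0.
  by rewrite mul0r invr0; exact: ht0.
by exists q, p; rewrite invf_div.
Qed.

Lemma htN h x : ht h x -> ht h (- x).
Proof. by move=> [p [q [q0 hp hq ->]]]; exists (- p), q; rewrite abszN mulrNz mulNr. Qed.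

Lemma htD h h' x y : ht h x -> ht h' y -> ht (h + h' + 1) (x + y).
Proof.
move=> [p [q [q0 hp hq ->]]] [p' [q' [q0' hp' hq' ->]]].
exists (p * q' + p' * q), (q * q'); split.
- by rewrite mulf_neq0.
- have absD (a b : int) : (`|(a + b)%R| <= `|a| + `|b|)%N by lia.
  apply: leq_trans (absD _ _) _; rewrite addn1 expnS mul2n -addnn !abszM expnD.
  by apply: leq_add; [|rewrite mulnC]; apply: leq_mul.
- rewrite abszM addn1 expnS expnD; apply: leq_trans (leq_mul hq hq') _.
  by rewrite leq_pmull.
- have qF : q%:~R != 0 :> F by rewrite intr_eq0.
  have qF' : q'%:~R != 0 :> F by rewrite intr_eq0.
  by rewrite addf_div // intrD !intrM.
Qed.

Lemma htB h h' x y : ht h x -> ht h' y -> ht (h + h' + 1) (x - y).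
Proof. by move=> hx hy; apply: htD => //; apply: htN. Qed.

Lemma ht_div h h' x y : ht h x -> ht h' y -> ht (h + h') (x / y).
Proof. by move=> hx hy; apply: htM => //; apply: htV. Qed.

Lemma ht_sum k h (f : 'I_k -> F) :
  (forall i, ht h (f i)) -> ht (k * (h + 1)) (\sum_(i < k) f i).
Proof.
elim: k f => [|k IH] f hf; first by rewrite big_ord0; exact: ht0.
rewrite big_ord_recr /=; apply: ht_le (htD (IH _ (fun i => hf _)) (hf _)).
rewrite mulSn; lia.
Qed.

(** In lowest terms, numerator and denominator divide p and q, by coprimality. Each then takes at
    most h + 1 bits, whence 1 + 2 (h + 1). *)
Lemma ht_rat h x : ht h x ->
  exists2 r : rat, x = ratr r & (rat_size r <= 2 * h + 3)%N.
Proof.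
move=> [p [q [q0 hp hq ->]]]; exists (p%:Q / q%:Q).
  by rewrite fmorph_div /= !ratr_int.
set r := _ / _; rewrite /rat_size.
have qQ : q%:Q != 0 by rewrite intr_eq0.
have e : numq r * q = p * denq r.
  apply: (@intr_inj rat); rewrite !intrM numqE /r; field => //.
have dq : (`|denq r| %| `|q|)%N.
  have /eqP := congr1 absz e; rewrite !abszM => /eqP E.
  have := dvdn_mull `|p|%N (dvdnn `|denq r|%N); rewrite -E Gauss_dvdr //.
  by rewrite coprime_sym coprime_num_den.
have np : (`|numq r| <= `|p|)%N.
  have /eqP := congr1 absz e; rewrite !abszM => /eqP E.
  have := dvdn_mulr `|q|%N (dvdnn `|numq r|%N); rewrite E Gauss_dvdl ?coprime_num_den //.
  (* Divisibility gives no bound when p = 0, but then the reduced numerator is 0 as well. *)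
  have [p0|p0] := eqVneq p 0; last by move/dvdn_leq; apply; rewrite absz_gt0.
  by rewrite /r p0 mul0r.
have up (k : int) : (`|k| <= 2 ^ h)%N -> (up_log 2 (`|k| + 1) <= h.+1)%N.
  move=> kh; apply: up_log_min => //; rewrite expnS; have := expn_gt0 2 h; lia.
have dq' : (`|denq r| <= `|q|)%N by apply: dvdn_leq; rewrite ?absz_gt0.
have := up _ (leq_trans np hp); have := up _ (leq_trans dq' hq); lia.
Qed.

Lemma rat_size_ht h r : (rat_size r <= h)%N -> ht h (ratr r).
Proof.
rewrite /rat_size => rh; exists (numq r), (denq r); split=> //.
- have := up_logP (`|numq r| + 1) (isT : (1 < 2)%N) => H.
  apply: leq_trans (leq_trans (leq_addr 1 _) H) _; rewrite leq_exp2l //; lia.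
- have := up_logP (`|denq r| + 1) (isT : (1 < 2)%N) => H.
  apply: leq_trans (leq_trans (leq_addr 1 _) H) _; rewrite leq_exp2l //; lia.
Qed.

End Height.

(** * Sizes of the intermediate projections, by Cramer's rule *)

Section GramSchmidtHeight.
Variables (F : realFieldType) (m N : nat) (B : 'M[F]_(m, N)).
Variables (D : int) (B' : 'M[int]_(m, N)) (h : nat).
Hypotheses (D0 : D != 0) (BE : map_mx intr B' = D%:~R *: B :> 'M[F]_(m, N)).
Hypotheses (Dh : (`|D| <= 2 ^ h)%N) (Bh : forall i j, (`|B' i j| <= 2 ^ h)%N).

(* The Gram matrix of the first i rows of B', completed by the identity so that
   its dimension does not depend on i. *)
Let G (i : nat) : 'M[int]_m :=
  \matrix_(a, b) if (a < i)%N && (b < i)%N then \sum_k B' a k * B' b k else (a == b)%:R.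

(** A vector x in the left kernel vanishes from coordinate i on because of the identity block. Hence
    |x B'|^2 = x G x^T = 0, so x B' = 0 and x = 0 by freeness. *)
Lemma gs_gram_unit i : row_free B -> \det (G i) != 0.
Proof.
move=> fB; apply/det0P => -[x x0 xG].
have xi (b : 'I_m) : (i <= b)%N -> x 0 b = 0.
  move=> ib; have /rowP/(_ b) := xG; rewrite !mxE (bigD1 b) //= mxE [(b < i)%N]ltnNge ib andbF eqxx mulr1.
  rewrite big1 ?addr0 // => a ab; rewrite mxE [(b < i)%N]ltnNge ib andbF (negbTE ab) mulr0 //.
have xBB : x *m B' *m (x *m B')^T = 0.
  rewrite trmx_mul mulmxA; apply/matrixP=> a c; rewrite mxE big1 ?[RHS]mxE // => b _.
  rewrite [x^T _ _]mxE (ord1 c); have [bi|/xi->] := ltnP b i; last by rewrite mulr0.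
  suff -> : (x *m B' *m B'^T) a b = (x *m G i) 0 b by rewrite xG mxE mul0r.
  rewrite -mulmxA !mxE (ord1 a); apply: eq_bigr => e _.
  have [ei|/xi->] := ltnP e i; last by rewrite !mul0r.
  by rewrite !mxE ei bi /=; congr (_ * _); apply: eq_bigr => k _; rewrite mxE.
have xB : map_mx intr x *m B = 0 :> 'rV[F]_N.
  apply/eqP; rewrite -(inj_eq (scalerI (_ : D%:~R != 0))) ?intr_eq0 // scaler0 scalemxAr -BE.
  apply/eqP/sumsq_row_eq0; rewrite -map_mxM map_trmx -map_mxM xBB !mxE //.
move: x0; apply/negP/negPn/eqP/rowP=> j.
have /eqP := xB; rewrite mulmx_free_eq0 // => /eqP/rowP/(_ j).
by rewrite !mxE => /eqP; rewrite intr_eq0 => /eqP.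
Qed.

(** For a < i, row a of B P = B + B B^T V is zero; multiplying by D^2 turns this into an integer
    linear system for V. As V vanishes from row i on, only the leading block of the Gram matrix
    meets its nonzero rows. *)
Lemma gs_gram_mul i P V : gs_inv B i P V ->
  map_mx intr (G i) *m V =
  - (map_mx intr (\matrix_(a, b) if (a < i)%N then D * B' a b else 0)) :> 'M[F]_(m, N).
Proof.
move=> [_ eP V0 BP]; apply/matrixP=> a j; rewrite [LHS]mxE [RHS]mxE [in RHS]mxE [in RHS]mxE.
have V0' (b : 'I_m) : (i <= b)%N -> V b j = 0.
  by move=> /V0/rowP/(_ j); rewrite !mxE.
have [ai|ia] := ltnP a i; last first.
  rewrite (bigD1 a) //= big1 ?addr0 => [|b ba].
    by rewrite !mxE [(a < i)%N]ltnNge ia /= eqxx mul1r V0' // oppr0.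
  by rewrite !mxE [(a < i)%N]ltnNge ia /= eq_sym (negbTE ba) mul0r.
have : row a (map_mx intr B' *m P) 0 j = 0.
  by rewrite BE row_mul linearZ /= -scalemxAl BP // scaler0 mxE.
rewrite {1}eP mulmxDr mulmx1 mulmxA mxE [in X in X -> _]mxE [in X in X + _]mxE => /eqP.
rewrite addrC addr_eq0 => /eqP E.
rewrite intrM -mulrN -E [in RHS]mxE mulr_sumr; apply: eq_bigr => b _.
have [bi|/V0' ->] := ltnP b i; last by rewrite !mulr0.
rewrite mulrA; congr (_ * _); rewrite !mxE ai bi /= rmorph_sum /= mulr_sumr.
apply: eq_bigr => k _; rewrite !mxE rmorphM /=.
have /matrixP/(_ b k) := BE; rewrite !mxE => ->; ring.
Qed.

(** Gram entries are at most N 2^(2h) <= 2^(N + 2h), so the middle term bounds the adjugate. The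
    last term bounds the right-hand side, and m <= 2^m covers the summation. *)
Definition gs_mult_ht : nat := (m + (m * m + m * (N + (h + h))) + (h + h))%N.
Definition gs_proj_ht : nat := (m * (h + gs_mult_ht + 1) + 1)%N.

(** V = - adj(G) W / det(G) by Cramer's rule. The bound does not depend on i: sizes do not compound
    over the successive updates. *)
Lemma gs_mult_height i P V : row_free B -> gs_inv B i P V ->
  forall j k, ht gs_mult_ht (V j k).
Proof.
move=> fB inv j k; set W := (\matrix_(a, b) if (a < i)%N then D * B' a b else 0) : 'M[int]_(m, N).
have Gb a b : (`|G i a b| <= 2 ^ (N + (h + h)))%N.
  rewrite mxE; case: ifP => _; last by case: (a == b); rewrite ?expn_gt0.
  apply: leq_trans (absz_sum_le (c := 2 ^ (h + h)) _) _.
    by move=> e; rewrite abszM expnD leq_mul.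
  by rewrite card_ord (expnD 2 N) leq_mul2r leq_exp2 orbT.
have d0 : (\det (G i))%:~R != 0 :> F by rewrite intr_eq0 gs_gram_unit.
have -> : V j k = (- (\adj (G i) *m W) j k)%:~R / (\det (G i))%:~R.
  apply: (canRL (mulfK d0)); rewrite mulrC.
  have <- : ((\det (G i))%:~R *: V) j k = (\det (G i))%:~R * V j k by rewrite mxE.
  rewrite -det_map_mx -mul_scalar_mx -mul_adj_mx -mulmxA (gs_gram_mul inv) -/W mulmxN.
  by rewrite -map_mx_adj -map_mxM /= !mxE rmorphN.
apply: ht_frac; first by rewrite gs_gram_unit.
- rewrite abszN mxE; apply: leq_trans (absz_sum_le (c := 2 ^ (m * m + m * (N + (h + h))) * 2 ^ (h + h)) _) _.
    move=> e; rewrite abszM leq_mul ?(adj_bound _ _ Gb) // mxE; case: ifP => // _.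
    by rewrite abszM expnD leq_mul.
  by rewrite card_ord /gs_mult_ht -!expnD -(addnA m) (expnD 2 m) leq_mul2r leq_exp2 orbT.
- by apply: leq_trans (det_bound Gb) _; rewrite leq_exp2l // /gs_mult_ht; lia.
Qed.

Lemma gs_row_height i j : ht h (B i j).
Proof.
have d0 : D%:~R != 0 :> F by rewrite intr_eq0.
have -> : B i j = (B' i j)%:~R / D%:~R.
  apply: (canRL (mulfK d0)); have /matrixP/(_ i j) := BE; rewrite !mxE => ->.
  by rewrite mulrC.
exact: ht_frac.
Qed.

Lemma gs_proj_height i P V : row_free B -> gs_inv B i P V ->
  forall j k, ht gs_proj_ht (P j k).
Proof.
move=> fB inv j k; have [_ -> _ _] := inv; rewrite !mxE addrC.
rewrite -[gs_proj_ht]/(_ + _)%N -[X in (X + 1)%N]addn0; apply: htD; last first.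
  by case: (j == k); [exact: ht1 | exact: ht0].
apply: ht_sum => e; rewrite mxE; apply: htM; [exact: gs_row_height|exact: gs_mult_height inv _ _].
Qed.

End GramSchmidtHeight.

(** * Growth of the squared norm in the perceptron *)

Section Perceptron.
Variables (F : realFieldType) (N : nat) (P : 'M[F]_N).
Hypotheses (sP : P^T = P) (iP : P *m P = P).

Definition quad (z : 'cV[F]_N) : F := (z^T *m P *m z) 0 0.

Lemma quadE z : quad z = \sum_k (P *m z) k 0 ^+ 2.
Proof.
rewrite /quad -{1}iP mulmxA -mulmxA -[X in z^T *m X]sP -trmx_mul mxE.
by apply: eq_bigr => k _; rewrite !mxE expr2.
Qed.

(** The squared norm of column k is [P k k] itself, and it contains the summand [P k k ^+ 2]. *)
Lemma proj_diag_le1 k : P k k <= 1.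
Proof.
have E : P k k = \sum_j P j k ^+ 2.
  rewrite -{1}iP mxE; apply: eq_bigr => j _.
  by rewrite -{1}sP mxE expr2.
have H : P k k ^+ 2 <= P k k.
  rewrite {2}E (bigD1 k) //= lerDl sumr_ge0 // => j _; exact: sqr_ge0.
nra.
Qed.

(** The increase is 2 (P z)_k + P_kk: the cross terms are nonpositive and the diagonal entry is at
    most 1. *)
Lemma quad_step z k : (P *m z) k 0 <= 0 ->
  quad (z + delta_mx k 0) <= quad z + 1.
Proof.
move=> pk; rewrite /quad [(_ + _)^T]linearD /= !mulmxDl !mulmxDr.
have E1 : (z^T *m P *m delta_mx k (0 : 'I_1)) 0 0 = (P *m z) k 0.
  by rewrite -colE mxE -[X in z^T *m X]sP -trmx_mul mxE.
have E2 : ((delta_mx k (0 : 'I_1))^T *m P *m z) 0 0 = (P *m z) k 0.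
  by rewrite trmx_delta -mulmxA -rowE mxE.
have E3 : ((delta_mx k (0 : 'I_1))^T *m P *m delta_mx k (0 : 'I_1)) 0 0 = P k k.
  by rewrite trmx_delta -mulmxA -rowE -colE !mxE.
have := proj_diag_le1 k; rewrite mxE [X in X + _]mxE [X in _ + X]mxE E1 E2 E3; lra.
Qed.

Lemma quad_delta_le1 k : quad (delta_mx k 0) <= 1.
Proof.
by rewrite /quad trmx_delta -mulmxA -rowE -colE !mxE; exact: proj_diag_le1.
Qed.

End Perceptron.

(** * Homogenized system *)

Section Homogenization.
Variables (R : realType) (m n : nat) (A : 'M[int]_(m, n)) (b : 'cV[int]_m).
Variable u : 'cV[R]_n.

(** Indexed by natural numbers and written with [0 - _], exactly as the program computes it, so that
    it can be equated with memory contents. *)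
Definition hom_fun (i j : nat) : R :=
  if (j < n)%N then store_mx (map_mx intr A) i j * store_mx u j 0
  else 0 - store_mx (map_mx intr b) i 0.

Definition hom_mx : 'M[R]_(m, n.+1) := load_mx m n.+1 hom_fun.

Lemma store_mxE k l (M : 'M[R]_(k, l)) (i : 'I_k) (j : 'I_l) : store_mx M i j = M i j.
Proof. by rewrite /store_mx !valK. Qed.

Let widen (j : 'I_n) : 'I_n.+1 := widen_ord (leqnSn n) j.

Lemma hom_mx_l i j : hom_mx i (widen j) = (A i j)%:~R * u j 0.
Proof.
by rewrite mxE /hom_fun /= ltn_ord store_mxE mxE -[0%N]/(nat_of_ord (0 : 'I_1)) store_mxE.
Qed.

Lemma hom_mx_r i : hom_mx i ord_max = - (b i 0)%:~R.
Proof.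
by rewrite mxE /hom_fun /= ltnn sub0r -[0%N]/(nat_of_ord (0 : 'I_1)) store_mxE mxE.
Qed.

Hypothesis u0 : forall i, 0 < u i 0.

(** The first n columns of x B are those of x A scaled by the positive u_j. *)
Lemma hom_mx_free : row_free (map_mx intr A : 'M[R]_(m, n)) -> row_free hom_mx.
Proof.
move=> fA; rewrite -kermx_eq0 -submx0; apply/rV_subP => x /sub_kermxP xB.
rewrite submx0 -(mulmx_free_eq0 _ fA); apply/eqP/rowP=> j.
have /rowP/(_ (widen j)) := xB; rewrite mxE [RHS]mxE.
under eq_bigr do rewrite hom_mx_l mulrA.
rewrite -mulr_suml => /eqP; rewrite mulf_eq0 (gt_eqF (u0 j)) orbF => /eqP E.
by rewrite [RHS]mxE -[RHS]E mxE; apply: eq_bigr => i _; rewrite mxE.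
Qed.

Lemma solution_valid (p : 'cV[R]_n.+1) : hom_mx *m p = 0 ->
  (forall j, 0 <= p (widen j) 0) -> 0 < p ord_max 0 ->
  valid_outcome A b u (Solution m (\col_j (u j 0 * (p (widen j) 0 / p ord_max 0)))).
Proof.
move=> Bp p0 pm; split; last first.
  by move=> i; rewrite mxE mulr_ge0 ?divr_ge0 ?p0 // ltW.
apply/colP=> i; have /colP/(_ i) := Bp; rewrite mxE [RHS]mxE big_ord_recr /= hom_mx_r mulNr => /eqP.
rewrite subr_eq0 => /eqP E; rewrite [RHS]mxE mxE.
apply: (mulIf (lt0r_neq0 pm)); rewrite -E mulr_suml; apply: eq_bigr => j _.
rewrite -[widen_ord _ _]/(widen j) hom_mx_l !mxE; field; exact: lt0r_neq0.
Qed.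

(** With y = x / u in the unit cube and t the last coordinate, p = z + B^T v turns the claim into
    sum_j p_j y_j + p_t < z_t + (K - z_t) / (2n). It suffices that the left side is below K / (2n).
    Positivity of z at index 0, which is not t since n > 0, gives w <> 0. *)
Lemma certificate_valid (z p : 'cV[R]_n.+1) (v : 'cV[R]_m) (K := \sum_j z j 0) :
  (0 < n)%N -> p = z + hom_mx^T *m v -> (forall j, 0 <= z j 0) ->
  0 < z ord0 0 -> \sum_j p j 0 ^+ 2 <= K -> (4 * n ^ 2 * n.+1)%:R < K ->
  valid_outcome A b u (Certificate v (\col_j (z (widen j) 0 / u j 0))).
Proof.
move=> n0 pE z0 z00 pK nK.
have nR : 0 < n%:R :> R by rewrite ltr0n.
split.
- by move=> i; rewrite mxE divr_ge0 // ltW.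
- apply/negP=> /eqP/colP/(_ (Ordinal n0)); rewrite !mxE => /eqP.
  rewrite mulf_eq0 invr_eq0 (gt_eqF (u0 _)) orbF.
  have -> : widen (Ordinal n0) = ord0 by apply: val_inj.
  by rewrite gt_eqF.
move=> x xu; pose y j := x j 0 / u j 0.
have y01 j : 0 <= y j <= 1.
  have /andP[x0 x1] := xu j; have uj := u0 j.
  by rewrite /y divr_ge0 ?(ltW uj) //= ler_pdivrMr // mul1r.
have -> : ((v^T *m map_mx intr A + (\col_j (z (widen j) 0 / u j 0))^T) *m x) 0 0 =
    \sum_j p (widen j) 0 * y j.
  rewrite mxE; apply: eq_bigr => j _; rewrite pE /y !mxE.
  have uj := lt0r_neq0 (u0 j).
  under [in RHS]eq_bigr => i _ do rewrite mxE hom_mx_l mulrAC [_ * v i 0]mulrC.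
  under [in LHS]eq_bigr => i _ do rewrite !mxE.
  rewrite -mulr_suml; field; exact: uj.
have -> : (v^T *m map_mx intr b) 0 0 = z ord_max 0 - p ord_max 0.
  rewrite pE mxE [in RHS]mxE [in RHS]mxE.
  under [in RHS]eq_bigr => i _ do rewrite mxE hom_mx_r mulNr mulrC.
  by rewrite sumrN opprD addrA subrr add0r opprK; apply: eq_bigr => i _; rewrite !mxE.
have -> : ((\col_j (z (widen j) 0 / u j 0))^T *m u) 0 0 = K - z ord_max 0.
  rewrite /K big_ord_recr /= addrK mxE; apply: eq_bigr => j _; rewrite !mxE.
  by rewrite divfK // lt0r_neq0.
(* A coordinatewise substitute for Cauchy-Schwarz: with a = 2nt this is n (t - c)^2 >= 0 together
   with c^2 <= 1. Summed over n + 1 coordinates, it gives K / (4n) + n (n + 1). *)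
have amgm (a c : R) : 0 <= c <= 1 -> a * c <= a ^+ 2 / (4 * n%:R) + n%:R.
  move=> /andP[c0 c1].
  have -> : a ^+ 2 / (4 * n%:R) + n%:R = (a / (2 * n%:R)) * (a / (2 * n%:R)) * n%:R + n%:R.
    by field; exact: lt0r_neq0.
  have {1}-> : a = (a / (2 * n%:R)) * (2 * n%:R) by field; exact: lt0r_neq0.
  set t := a / _; have : 0 <= n%:R * ((t - c) ^+ 2 + (1 - c ^+ 2)).
    rewrite mulr_ge0 ?(ltW nR) // addr_ge0 ?sqr_ge0 // subr_ge0 expr_le1 //.
  lra.
have sum_le : \sum_j p (widen j) 0 * y j + p ord_max 0 <= K / (4 * n%:R) + n.+1%:R * n%:R.
  apply: le_trans (_ : \sum_j (p j 0 ^+ 2 / (4 * n%:R) + n%:R) <= _); last first.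
    rewrite big_split /= -mulr_suml sumr_const card_ord -[n%:R *+ _]mulr_natl lerD2r.
    by rewrite ler_pM2r // invr_gt0 mulr_gt0.
  rewrite big_ord_recr /=; apply: lerD; last by rewrite -[X in X <= _]mulr1 amgm // ler01 lexx.
  by apply: ler_sum => j _; apply: amgm.
have zm := z0 ord_max.
have K4 : n.+1%:R * n%:R < K / (4 * n%:R).
  rewrite ltr_pdivlMr ?mulr_gt0 //; apply: le_lt_trans nK.
  by rewrite -[(n ^ 2)%N]/(n * n)%N !natrM; lra.
(* The weight z_t is missing from w^T u, but v^T b supplies it in full. *)
have n1 : z ord_max 0 / (2 * n%:R) <= z ord_max 0.
  rewrite ler_pdivrMr ?mulr_gt0 // ler_peMr //; have : 1 <= n%:R :> R by rewrite ler1n.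
  lra.
have -> : 1 / (2 * n%:R) * (K - z ord_max 0) = K / (4 * n%:R) + K / (4 * n%:R) - z ord_max 0 / (2 * n%:R).
  by field; exact: lt0r_neq0.
lra.
Qed.

End Homogenization.

(** * The algorithm *)

(* aB, aProj, aMult, aP, aV, aZ hold B, P, V, p, v, z; for the row b_i being
   processed, aQ, aY, aDelta, aDual hold q = P b_i, y = V b_i + e_i, delta = b_i^T q
   and q^T / delta, after which P := P - q q^T / delta, V := V - y q^T / delta. *)
Local Notation cM := 0%N (only parsing).
Local Notation cN := 1%N (only parsing).
Local Notation cOut := 2%N (only parsing).
Local Notation cN1 := 3%N (only parsing).
Local Notation cI := 4%N (only parsing).
Local Notation cR := 5%N (only parsing).
Local Notation cC := 6%N (only parsing).
Local Notation cK := 7%N (only parsing).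
Local Notation aU := 2%N (only parsing).
Local Notation aX := 3%N (only parsing).
Local Notation aV := 4%N (only parsing).
Local Notation aZ := 5%N (only parsing).
Local Notation aB := 6%N (only parsing).
Local Notation aProj := 7%N (only parsing).
Local Notation aMult := 8%N (only parsing).
Local Notation aQ := 9%N (only parsing).
Local Notation aY := 10%N (only parsing).
Local Notation aDelta := 11%N (only parsing).
Local Notation aDual := 12%N (only parsing).
Local Notation aP := 16%N (only parsing).

Definition c0 : idx := ICst 0.
Definition tmp : cell := Cell 13 c0 c0.
Definition one : cell := Cell 14 c0 c0.
Definition zero : cell := Cell 15 c0 c0.
Definition delta : cell := Cell aDelta c0 c0.

Definition build_hom : program :=
  for_loop cI (IVar cM) (Seq
    (for_loop cC (IVar cN)
      (Arith (Cell aB (IVar cI) (IVar cC)) OpMul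
         (Cell 0 (IVar cI) (IVar cC)) (Cell 2 (IVar cC) c0)))
    (Arith (Cell aB (IVar cI) (IVar cN)) OpSub zero (Cell 1 (IVar cI) c0))).

(** Only the diagonal is written, since memory outside the input arrays starts at zero; for the same
    reason V needs no initialization. *)
Definition build_id : program :=
  for_loop cC (IVar cN1) (SetNum (Cell aProj (IVar cC) (IVar cC)) 1).

(** The result goes to row 0, so that q can in turn be the source, as a matrix with one row: with
    bound 1 this computes the scalar delta. *)
Definition matvec (dst src : nat) (bnd : idx) : program :=
  for_loop cR bnd (Seq
    (SetNum (Cell dst c0 (IVar cR)) 0)
    (for_loop cC (IVar cN1) (Seq
      (Arith tmp OpMul (Cell src (IVar cR) (IVar cC)) (Cell aB (IVar cI) (IVar cC)))
      (Arith (Cell dst c0 (IVar cR)) OpAdd (Cell dst c0 (IVar cR)) tmp)))).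

Definition scale_dual : program :=
  for_loop cC (IVar cN1)
    (Arith (Cell aDual c0 (IVar cC)) OpDiv (Cell aQ c0 (IVar cC)) delta).

Definition rank_one (dst src : nat) (bnd : idx) : program :=
  for_loop cR bnd (for_loop cC (IVar cN1) (Seq
    (Arith tmp OpMul (Cell src c0 (IVar cR)) (Cell aDual c0 (IVar cC)))
    (Arith (Cell dst (IVar cR) (IVar cC)) OpSub (Cell dst (IVar cR) (IVar cC)) tmp))).

Definition add_col (dst src : nat) (bnd : idx) : program :=
  for_loop cR bnd
    (Arith (Cell dst (IVar cR) c0) OpAdd (Cell dst (IVar cR) c0)
       (Cell src (IVar cR) (IVar cK))).

(** * Specifications of the linear algebra routines *)

Section Specs.
Variables (R : realType) (Z : R -> Prop).
Implicit Types s : state R.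

Lemma matvec_spec dst src bnd K N s :
  ieval s bnd = K -> ctr s cN1 = N -> idx_fresh bnd [:: cR; cC] ->
  dst \notin [:: src; aB; 13%N] -> src != 13%N ->
  let f := mem s src in let g := mem s aB (ctr s cI) in
  (forall r c, (r < K)%N -> (c < N)%N -> Z (f r c * g c)) ->
  (forall r c, (r < K)%N -> (c < N)%N -> Z (\sum_(i < c.+1) f r i * g i)) ->
  runs Z (matvec dst src bnd) s (K * (N * 2)) (K * (N * 4 + 5) + 2)
    (fun s' => forall r, (r < K)%N -> mem s' dst 0 r = \sum_(i < N) f r i * g i).
Proof.
move=> bK cN fb; rewrite !inE !negb_or => /and3P[ds /negbTE db /negbTE dt] /negbTE st f g Zp Zs.
apply: (@runs_weaken _ _ _ _ (K * (0 + N * (1 + 1))) (K * (1 + (N * (1 + 1 + 2) + 2) + 2) + 2) _ _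
  (fun s' => forall r, (r < K)%N -> mem s' dst 0 r = \sum_(i < N) f r i * g i)); [|lia|lia|by []].
apply: (@runs_for _ _ _ _ _ s K _ _
  (fun k s' => forall r, (r < k)%N -> mem s' dst 0 r = \sum_(i < N) f r i * g i)) => //.
  by case: (bnd) fb => //= y; rewrite !inE !negb_or => /andP[-> ->].
move=> k s' kK ck [fc fm] I.
have wm a : a != dst -> a != 13%N -> mem s' a = mem s a.
  by move=> /negbTE ad /negbTE at_; rewrite fm //= !inE !ad !at_.
apply: runs_seq; apply: runs_setnum => /=.
set s1 := State _ _.
(* Entry k is being accumulated while the earlier ones are final; the two branches agree once the
   inner loop ends. *)
apply: runs_post (_ : runs _ _ s1 _ _ (fun s2 => forall r, (r < k.+1)%N ->
  mem s2 dst 0 r = if r == k then \sum_(i < N) f r i * g i else \sum_(i < N) f r i * g i)) _; last first.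
  by move=> s2 _ H r rk /=; rewrite H // if_same.
apply: (@runs_for _ _ _ _ _ s1 N _ _ (fun j s2 => forall r, (r < k.+1)%N ->
  mem s2 dst 0 r = if r == k then \sum_(i < j) f r i * g i else \sum_(i < N) f r i * g i)) => //.
- by rewrite /= -cN fc.
- move=> r rk /=; rewrite !eqxx ck; case: eqP => [_|rk']; first by rewrite big_ord0.
  by rewrite I // ltn_neqAle -ltnS rk andbT; apply/eqP.
move=> j s2 jN cj [fc2 fm2] I2.
have cr : ctr s2 cR = k by rewrite fc2.
have ci : ctr s2 cI = ctr s cI by rewrite fc2 //= fc.
have ms : mem s2 src = f.
  rewrite fm2 /=; last by rewrite !inE st (eq_sym src) (negbTE ds).
  apply: boolp.funext => x; apply: boolp.funext => y; rewrite /s1 /= [src == dst]eq_sym (negbTE ds) /=.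
  by rewrite wm ?st // eq_sym.
have mb : mem s2 aB (ctr s cI) = g.
  rewrite fm2 /=; last by rewrite !inE (eq_sym 6%N dst) db.
  by apply: boolp.funext => y; rewrite /s1 /= (eq_sym 6%N dst) db /= wm // eq_sym db.
apply: runs_seq; apply: runs_arith => //=.
  by rewrite ms cr ci cj mb; exact: Zp.
have E0 : mem s2 dst 0 k + f k j * g j = \sum_(i < j.+1) f k i * g i.
  by rewrite I2 // eqxx big_ord_recr.
rewrite ms cr ci cj mb; apply: runs_arith => //=; rewrite ?eqxx ?cr dt /= E0; first exact: Zs.
move=> r rk; case: eqP => [->//|/eqP/negbTE rk'].
by rewrite I2 // rk'.
Qed.

Lemma rank_one_spec dst src bnd K N s :
  ieval s bnd = K -> ctr s cN1 = N -> idx_fresh bnd [:: cR; cC] ->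
  dst \notin [:: src; aDual; 13%N] -> src != 13%N ->
  let f := mem s dst in let y := mem s src 0 in let d := mem s aDual 0 in
  (forall r c, (r < K)%N -> (c < N)%N -> Z (y r * d c)) ->
  (forall r c, (r < K)%N -> (c < N)%N -> Z (f r c - y r * d c)) ->
  runs Z (rank_one dst src bnd) s (K * (N * 2)) (K * (N * 4 + 5) + 2)
    (fun s' => forall r c, (r < K)%N -> (c < N)%N -> mem s' dst r c = f r c - y r * d c).
Proof.
move=> bK cN fb; rewrite !inE !negb_or => /and3P[ds /negbTE dd /negbTE dt] /negbTE st f y d Zp Zs.
(* The postcondition is rewritten as the loop invariant at its final index: rows below the current
   one are updated, the others untouched. *)
apply: (@runs_weaken _ _ _ _ (K * (N * (1 + 1))) (K * (N * (1 + 1 + 2) + 2 + 2) + 2) _ _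
  (fun s' => forall r c, (r < K)%N -> (c < N)%N ->
     mem s' dst r c = f r c - if (r < K)%N then y r * d c else 0)); [|lia|lia|]; last first.
  by move=> s' _ H r c rK cK; rewrite H // rK.
apply: (@runs_for _ _ _ _ _ s K _ _ (fun k s' => forall r c, (r < K)%N -> (c < N)%N ->
     mem s' dst r c = f r c - if (r < k)%N then y r * d c else 0)) => //.
- by case: (bnd) fb => //= x; rewrite !inE !negb_or => /andP[-> ->].
- by move=> r c _ _ /=; rewrite subr0.
move=> k s1 kK ck [fc fm] I.
have wm a : a != dst -> a != 13%N -> mem s1 a = mem s a.
  by move=> /negbTE ad /negbTE at_; rewrite fm //= !inE !ad !at_.
apply: runs_post (_ : runs _ _ s1 _ _ (fun s2 => forall r c, (r < K)%N -> (c < N)%N ->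
  mem s2 dst r c = f r c - if (r < k)%N || (r == k) && (c < N)%N then y r * d c else 0)) _; last first.
  by move=> s2 _ H r c rk cN' /=; rewrite H // cN' andbT ltnS [(r <= k)%N]leq_eqVlt orbC.
apply: (@runs_for _ _ _ _ _ s1 N _ _ (fun j s2 => forall r c, (r < K)%N -> (c < N)%N ->
  mem s2 dst r c = f r c - if (r < k)%N || (r == k) && (c < j)%N then y r * d c else 0)) => //.
- by rewrite /= -cN fc.
- by move=> r c rK cN'; rewrite /= I // andbF orbF.
move=> j s2 jN cj [fc2 fm2] I2.
have cr : ctr s2 cR = k by rewrite fc2.
have ms : mem s2 src 0 = y.
  rewrite fm2 /=; last by rewrite !inE st (eq_sym src) (negbTE ds).
  by rewrite wm ?st // eq_sym.
have mb : mem s2 aDual 0 = d.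
  rewrite fm2 /=; last by rewrite !inE (eq_sym 12%N dst) dd.
  by rewrite wm // eq_sym dd.
apply: runs_seq; apply: runs_arith => //=.
  by rewrite ms cr cj mb; exact: Zp.
have E0 : mem s2 dst k j - y k * d j = f k j - y k * d j.
  by rewrite I2 // ltnn ltnn andbF subr0.
rewrite ms cr cj mb; apply: runs_arith => //=; rewrite ?eqxx ?cr ?cj dt /= E0; first exact: Zs.
move=> r c rK cN'; case: eqP => [->|/eqP/negbTE rk'] /=; last by rewrite I2 // rk'.
case: eqP => [->|/eqP/negbTE cj'] /=; first by rewrite ltnS leqnn orbT.
by rewrite I2 // eqxx ltnS [(c <= j)%N]leq_eqVlt cj'.
Qed.

Lemma add_col_spec dst src bnd K s :
  ieval s bnd = K -> idx_fresh bnd [:: cR] -> dst != src ->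
  let f r := mem s dst r 0 + mem s src r (ctr s cK) in
  (forall r, (r < K)%N -> Z (f r)) ->
  runs Z (add_col dst src bnd) s K (K * 3 + 2)
    (fun s' => forall r, (r < K)%N -> mem s' dst r 0 = f r).
Proof.
move=> bK fb ds f Zf.
apply: (@runs_weaken _ _ _ _ (K * 1) (K * (1 + 2) + 2) _ _
  (fun s' => forall r, (r < K)%N -> mem s' dst r 0 = if (r < K)%N then f r else mem s dst r 0));
  [|lia|lia|by move=> s' _ H r rK; rewrite H // rK].
apply: (@runs_for _ _ _ _ _ s K _ _ (fun k s' => forall r, (r < K)%N ->
  mem s' dst r 0 = if (r < k)%N then f r else mem s dst r 0)) => //.
move=> k s1 kK ck [fc fm] I.
have E : mem s1 dst k 0 + mem s1 src k (ctr s1 cK) = f k.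
  by rewrite I // ltnn fm ?fc //= inE eq_sym.
apply: runs_arith => //=; rewrite ck E; first exact: Zf.
move=> r rK /=; rewrite !eqxx andbT /=; case: eqP => [->|/eqP/negbTE rk']; first by rewrite ltnSn.
by rewrite I // ltnS [(r <= k)%N]leq_eqVlt rk'.
Qed.

Lemma scale_dual_spec N s :
  ctr s cN1 = N -> get s delta != 0 ->
  let f c := mem s aQ 0 c / mem s aDelta 0 0 in
  (forall c, (c < N)%N -> Z (f c)) ->
  runs Z scale_dual s N (N * 3 + 2)
    (fun s' => forall c, (c < N)%N -> mem s' aDual 0 c = f c).
Proof.
move=> cN d0 f Zf.
apply: (@runs_weaken _ _ _ _ (N * 1) (N * (1 + 2) + 2) _ _
  (fun s' => forall c, (c < N)%N -> mem s' aDual 0 c = f c)); [|lia|lia|by []].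
apply: (@runs_for _ _ _ _ _ s N _ _ (fun k s' => forall c, (c < k)%N ->
  mem s' aDual 0 c = f c)) => //.
move=> k s1 kK ck [fc fm] I.
apply: runs_arith => /= [_||]; rewrite ?ck ?(fm aQ) // (fm aDelta) //; first exact: Zf.
move=> r rk /=; case: eqP => [->//|/eqP rk'].
by rewrite I // ltn_neqAle rk' -ltnS.
Qed.

Lemma build_hom_spec m n s :
  ctr s cM = m -> ctr s cN = n -> get s zero = 0 ->
  let f i c := if (c < n)%N then mem s 0 i c * mem s 2 c 0 else 0 - mem s 1 i 0 in
  (forall i c, (i < m)%N -> (c <= n)%N -> Z (f i c)) ->
  runs Z build_hom s (m * (n + 1)) (m * (n * 3 + 5) + 2)
    (fun s' => forall i c, (i < m)%N -> (c <= n)%N -> mem s' aB i c = f i c).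
Proof.
move=> cm cn z0 f Zf.
apply: (@runs_weaken _ _ _ _ (m * (n * 1 + 1)) (m * (n * (1 + 2) + 2 + 1 + 2) + 2) _ _
  (fun s' => forall i c, (i < m)%N -> (c <= n)%N -> mem s' aB i c = f i c)); [|lia|lia|by []].
apply: (@runs_for _ _ _ _ _ s m _ _ (fun k s' => forall i c, (i < k)%N -> (c <= n)%N ->
  mem s' aB i c = f i c)) => //.
move=> k s1 kK ck [fc fm] I; apply: runs_seq.
(* After the inner loop, row k is complete except for its last entry, the one coming from b. *)
apply: runs_post (_ : runs _ _ s1 _ _ (fun s2 => forall i c, (i < k.+1)%N -> (c <= n)%N ->
  (i < k)%N || (c < n)%N -> mem s2 aB i c = f i c)) _.
  apply: (@runs_for _ _ _ _ _ s1 n _ _ (fun j s2 => forall i c, (i < k.+1)%N -> (c <= n)%N ->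
    (i < k)%N || (c < j)%N -> mem s2 aB i c = f i c)) => //.
  - by rewrite /= fc.
  - by move=> i c ik cn'; rewrite orbF => ik' /=; exact: I.
  move=> j s2 jn cj [fc2 fm2] I2.
  have ci : ctr s2 cI = k by rewrite fc2.
  have E : mem s2 0 k j * mem s2 2 j 0 = f k j by rewrite /f jn !fm2 //= !fm.
  apply: runs_arith => //=; rewrite cj ci E; first by apply: Zf => //; exact: ltnW.
  move=> i c ik cn'; case: eqP => [->|/eqP/negbTE ik'] /= ikc.
    case: eqP => [->//|/eqP/negbTE cj']; apply: I2 => //.
    by move: ikc; rewrite ltnn /= ltnS [(c <= j)%N]leq_eqVlt cj'.
  by apply: I2 => //; move: ik; rewrite ltnS [(i <= k)%N]leq_eqVlt ik' /= => ->.
move=> s2 [fc2 fm2] I2.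
have ci : ctr s2 cI = k by rewrite fc2.
have cn2 : ctr s2 cN = n by rewrite fc2 //= fc.
have E : mem s2 15 0 0 - mem s2 1 k 0 = f k n by rewrite /f ltnn !fm2 //= !fm //= -z0.
apply: runs_arith => //=; rewrite ci ?cn2 E; first exact: Zf.
move=> i c ik cn' /=; case: eqP => [->|/eqP/negbTE ik'] /=.
  case: eqP => [->//|/eqP cj']; apply: I2 => //.
  by rewrite [(c < n)%N]ltn_neqAle cn' cj' orbT.
by apply: I2 => //; move: ik; rewrite ltnS [(i <= k)%N]leq_eqVlt ik' /= => ->.
Qed.

Lemma build_id_spec N s :
  ctr s cN1 = N -> (forall i j, mem s aProj i j = 0) ->
  runs Z build_id s 0 (N * 3 + 2)
    (fun s' => forall i j, (i < N)%N -> mem s' aProj i j = (i == j)%:R).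
Proof.
move=> cN p0.
apply: (@runs_weaken _ _ _ _ (N * 0) (N * (1 + 2) + 2) _ _
  (fun s' => forall i j, mem s' aProj i j = ((i == j) && (i < N)%N)%:R)); [|lia|lia|]; last first.
  by move=> s' _ H i j iN; rewrite H iN andbT.
apply: (@runs_for _ _ _ _ _ s N _ _ (fun k s' => forall i j,
  mem s' aProj i j = ((i == j) && (i < k)%N)%:R)) => //.
  by move=> i j; rewrite /= p0 ltn0 andbF.
move=> k s1 kN ck _ I; apply: runs_setnum => /= i j /=; rewrite ck.
case: eqP => [->|/eqP/negbTE ik] /=; last by rewrite I ltnS [(i <= k)%N]leq_eqVlt ik.
case: eqP => [->|/eqP/negbTE jk]; first by rewrite eqxx ltnSn.
by rewrite I (eq_sym k j) jk.
Qed.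

End Specs.

(** * Polynomial size bounds in terms of the input *)

Section InputHeights.
Variables (R : realType) (m n : nat) (A : 'M[int]_(m, n)) (b : 'cV[int]_m).
Variable u : 'cV[R]_n.

Definition input_bound (L : nat) : Prop :=
  [/\ forall i j, (`|A i j| <= 2 ^ L)%N, forall i, (`|b i 0%R| <= 2 ^ L)%N,
      forall j, ht L (u j 0) & (m <= L)%N /\ (n <= L)%N].

(** Quantifying over every bound L covers real and rational u together: if some u_j is irrational
    there is no such L and the claim is vacuous. The base is at least 3, so adding two heights plus
    1 raises the exponent by only one. *)
Definition pht (k : nat) (x : R) : Prop :=
  forall L, input_bound L -> ht ((L + 3) ^ k) x.

Lemma pht_le k l x : (k <= l)%N -> pht k x -> pht l x.
Proof.
by move=> kl hx L hL; apply: ht_le (hx L hL); rewrite leq_pexp2l // addn3.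
Qed.

Lemma pht_exp_add L k l :
  ((L + 3) ^ k + (L + 3) ^ l + 1 <= (L + 3) ^ (maxn k l).+1)%N.
Proof.
have Hk : ((L + 3) ^ k <= (L + 3) ^ maxn k l)%N by rewrite leq_pexp2l ?addn3 // leq_maxl.
have Hl : ((L + 3) ^ l <= (L + 3) ^ maxn k l)%N by rewrite leq_pexp2l ?addn3 // leq_maxr.
have H1 : (0 < (L + 3) ^ maxn k l)%N by rewrite expn_gt0 addn3.
rewrite expnS; nia.
Qed.

Lemma phtM k l x y : pht k x -> pht l y -> pht (maxn k l).+1 (x * y).
Proof.
move=> hx hy L hL; apply: ht_le (htM (hx L hL) (hy L hL)).
by apply: leq_trans (pht_exp_add _ _ _); rewrite leq_addr.
Qed.

Lemma pht_div k l x y : pht k x -> pht l y -> pht (maxn k l).+1 (x / y).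
Proof.
move=> hx hy L hL; apply: ht_le (ht_div (hx L hL) (hy L hL)).
by apply: leq_trans (pht_exp_add _ _ _); rewrite leq_addr.
Qed.

Lemma phtD k l x y : pht k x -> pht l y -> pht (maxn k l).+1 (x + y).
Proof.
move=> hx hy L hL; apply: ht_le (htD (hx L hL) (hy L hL)); exact: pht_exp_add.
Qed.

Lemma phtB k l x y : pht k x -> pht l y -> pht (maxn k l).+1 (x - y).
Proof.
move=> hx hy L hL; apply: ht_le (htB (hx L hL) (hy L hL)); exact: pht_exp_add.
Qed.

Lemma pht1 k : pht k 1.
Proof. by move=> L _; exact: ht1. Qed.

Lemma pht_sum k l (f : 'I_k -> R) : (k <= n.+1)%N ->
  (forall i, pht l (f i)) -> pht l.+2 (\sum_(i < k) f i).
Proof.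
move=> kn hf L hL; apply: ht_le (ht_sum (fun i => hf i L hL)).
have [_ _ _ [_ nL]] := hL; rewrite !expnS.
have : (0 < (L + 3) ^ l)%N by rewrite expn_gt0 addn3.
nia.
Qed.

(** The crude estimate k <= 2 ^ k takes the weight itself as its height; (L + 3) ^ 2 >= 9 absorbs
    the constants. *)
Lemma pht_count (k : nat) : (k <= 8 * n ^ 3 + 1)%N -> pht 5 k%:R.
Proof.
move=> kn L hL; have [_ _ _ [_ nL]] := hL.
rewrite pmulrn; apply: ht_int; rewrite absz_nat.
apply: leq_trans (leq_exp2 _) _; rewrite leq_exp2l //; apply: leq_trans kn _.
have H : (n ^ 3 <= (L + 2) ^ 3)%N by rewrite leq_exp2r // (leq_trans nL) // leq_addr.
have -> : ((L + 3) ^ 5 = (L + 3) ^ 2 * (L + 3) ^ 3)%N by rewrite -expnD.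
have : (9 <= (L + 3) ^ 2)%N by rewrite expnS expn1; nia.
have : ((L + 2) ^ 3 < (L + 3) ^ 3)%N by rewrite ltn_exp2r // ltn_add2l.
nia.
Qed.

Lemma pht_input j : pht 1 (u j 0).
Proof.
by move=> L [_ _ hu _]; apply: ht_le (hu j); rewrite expn1 leq_addr.
Qed.

(** D is the product of the denominators of u, at most L factors of size 2 ^ L. The other 2 L bits
    pay for an entry of A and a numerator of u. *)
Lemma hom_scaled L : input_bound L ->
  exists (D : int) (B' : 'M[int]_(m, n.+1)),
  [/\ D != 0, map_mx intr B' = D%:~R *: hom_mx A b u :> 'M[R]_(m, n.+1),
      (`|D| <= 2 ^ (L * L + 2 * L))%N &
      forall i j, (`|B' i j| <= 2 ^ (L * L + 2 * L))%N].
Proof.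
move=> [hA hb hu [mL nL]].
have /boolp.choice[pq hpq] : forall j, exists pq : int * int,
    [/\ pq.2 != 0, (`|pq.1| <= 2 ^ L)%N, (`|pq.2| <= 2 ^ L)%N & u j 0 = pq.1%:~R / pq.2%:~R].
  by move=> j; have [p [q H]] := hu j; exists (p, q).
have prod_le (Q : pred 'I_n) : (`|(\prod_(k | Q k) (pq k).2)%R| <= 2 ^ (L * L))%N.
  have -> : `|(\prod_(k | Q k) (pq k).2)%R|%N = (\prod_(k | Q k) `|(pq k).2|)%N.
    by apply: (big_morph absz) => // x y; rewrite abszM.
  apply: leq_trans (_ : \prod_(k | Q k) 2 ^ L <= _)%N.
    by apply: leq_prod => k _; have [_ _ ? _] := hpq k.
  rewrite prod_nat_const -expnM leq_exp2l // leq_mul2l; apply/orP; right.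
  by apply: leq_trans (max_card _) _; rewrite card_ord.
pose D : int := \prod_k (pq k).2.
pose B' : 'M[int]_(m, n.+1) := \matrix_(i, j)
  if insub (nat_of_ord j) is Some j' then
    A i j' * ((pq j').1 * \prod_(k | k != j') (pq k).2) else - (D * b i 0).
exists D, B'; split.
- by apply/prodf_neq0 => j _; have [] := hpq j.
- apply/matrixP=> i j; rewrite !mxE /hom_fun; case: insubP => [j' jn E|]; last first.
    rewrite -leqNgt => nj; rewrite ltnNge nj /= sub0r -[0%N]/(nat_of_ord (0 : 'I_1)) store_mxE mxE.
    by rewrite mulrNz intrM mulrN.
  rewrite jn -E -[0%N]/(nat_of_ord (0 : 'I_1)) !store_mxE mxE.
  have [q0 _ _ ->] := hpq j'.
  rewrite [D](bigD1 j') //= !intrM; field; by rewrite intr_eq0.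
- by apply: leq_trans (prod_le _) _; rewrite leq_exp2l // leq_addr.
move=> i j; rewrite mxE.
have -> : (L * L + 2 * L = L + (L + L * L))%N by lia.
rewrite !expnD; case: insubP => [j' _ _|_].
  rewrite !abszM leq_mul // leq_mul //; by have [] := hpq j'.
rewrite abszN abszM mulnC leq_mul //.
by apply: leq_trans (prod_le _) _; rewrite leq_pmull // expn_gt0.
Qed.

Lemma hom_height i j : pht 6 (hom_mx A b u i j).
Proof.
move=> L hL; have [D [B' [D0 BE Dh Bh]]] := hom_scaled hL.
apply: ht_le (gs_row_height D0 BE Dh Bh i j).
have -> : ((L + 3) ^ 6 = (L + 3) ^ 4 * ((L + 3) * (L + 3)))%N by rewrite (expnD _ 4 2).
have : (0 < (L + 3) ^ 4)%N by rewrite expn_gt0 addn3.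
nia.
Qed.

Lemma mult_height_le L : (m <= L)%N -> (n <= L)%N ->
  (gs_mult_ht m n.+1 (L * L + 2 * L) <= 4 * (L + 3) ^ 3)%N.
Proof.
move=> mL nL; rewrite /gs_mult_ht.
apply: leq_trans (_ : L + (L * L + L * (L.+1 + (L * L + 2 * L + (L * L + 2 * L)))) +
  (L * L + 2 * L + (L * L + 2 * L)) <= _)%N; last by rewrite !expnS expn0; nia.
by rewrite leq_add2r leq_add // leq_add // leq_mul // leq_add2r.
Qed.

Hypotheses (u0 : forall i, 0 < u i 0) (fA : row_free (map_mx intr A : 'M[R]_(m, n))).

Lemma mult_height i P V : gs_inv (hom_mx A b u) i P V -> forall j k, pht 6 (V j k).
Proof.
move=> inv j k L hL; have [D [B' [D0 BE Dh Bh]]] := hom_scaled hL.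
have [_ _ _ [mL nL]] := hL.
apply: ht_le (gs_mult_height D0 BE Dh Bh (hom_mx_free b u0 fA) inv j k).
apply: leq_trans (mult_height_le mL nL) _.
have -> : ((L + 3) ^ 6 = (L + 3) ^ 3 * (L + 3) ^ 3)%N by rewrite -expnD.
by rewrite leq_mul2r; apply/orP; right; rewrite (leq_trans (_ : _ <= 3 ^ 3)%N) // leq_exp2r // leq_addl.
Qed.

Lemma proj_height i P V : gs_inv (hom_mx A b u) i P V -> forall j k, pht 6 (P j k).
Proof.
move=> inv j k L hL; have [D [B' [D0 BE Dh Bh]]] := hom_scaled hL.
have [_ _ _ [mL nL]] := hL.
apply: ht_le (gs_proj_height D0 BE Dh Bh (hom_mx_free b u0 fA) inv j k).
rewrite /gs_proj_ht.
apply: leq_trans (_ : L * (L * L + 2 * L + 4 * (L + 3) ^ 3 + 1) + 1 <= _)%N.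
  by rewrite leq_add2r leq_mul // leq_add2r leq_add2l mult_height_le.
have -> : ((L + 3) ^ 6 = (L + 3) ^ 3 * (L + 3) * ((L + 3) * (L + 3)))%N by rewrite -!expnSr mulnA -!expnSr.
have : (L * L + 2 * L + 1 <= (L + 3) ^ 3)%N by rewrite !expnS expn0; nia.
have : (0 < (L + 3) ^ 3)%N by rewrite expn_gt0 addn3.
nia.
Qed.

End InputHeights.

(** * The program *)

Definition gs_body : program :=
  Seq (matvec aQ aProj (IVar cN1))
  (Seq (matvec aY aMult (IVar cM))
  (Seq (Arith (Cell aY c0 (IVar cI)) OpAdd (Cell aY c0 (IVar cI)) one)
  (Seq (matvec aDelta aQ (ICst 1))
  (Seq scale_dual
  (Seq (rank_one aProj aQ (IVar cN1))
       (rank_one aMult aY (IVar cM))))))).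

Definition update : program :=
  Seq (Arith (Cell aZ (IVar cK) c0) OpAdd (Cell aZ (IVar cK) c0) one)
  (Seq (add_col aP aProj (IVar cN1))
       (add_col aV aMult (IVar cM))).

(** The value n + 1 signals that no index was found. The tests differ because p_t must be positive
    and the other coordinates only nonnegative. *)
Definition find : program :=
  Seq (SetCtr cK (IVar cN1))
  (Seq (If (NumLe (Cell aP (IVar cN) c0) zero) (SetCtr cK (IVar cN)) Skip)
       (for_loop cR (IVar cN)
          (If (NumLe zero (Cell aP (IVar cR) c0)) Skip (SetCtr cK (IVar cR))))).

Definition step : program := Seq find (If (CtrLt (IVar cK) (IVar cN1)) update Skip).

(** Counters cannot be multiplied, so 8 n^3 rounds are obtained by nesting loops. *)
Definition iterate : program :=
  for_loop 8 (IVar cN) (for_loop 9 (IVar cN) (for_loop 10 (IVar cN)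
    (for_loop 11 (ICst 8) step))).

Definition emit_solution : program :=
  for_loop cR (IVar cN) (Seq
    (Arith tmp OpDiv (Cell aP (IVar cR) c0) (Cell aP (IVar cN) c0))
    (Arith (Cell aX (IVar cR) c0) OpMul (Cell aU (IVar cR) c0) tmp)).

(** v and z already occupy the output arrays 4 and 5, so v is in place and z is divided by u in
    place. *)
Definition emit_certificate : program :=
  Seq (SetCtr cOut (ICst 1))
    (for_loop cR (IVar cN)
       (Arith (Cell aZ (IVar cR) c0) OpDiv (Cell aZ (IVar cR) c0) (Cell aU (IVar cR) c0))).

(** The [update] at index 0 before the iterations starts the weights at z = e_0, which later
    guarantees w <> 0. *)
Definition solver : program :=
  Seq (SetCtr cN1 (IVar cN))
  (Seq (IncrCtr cN1)
  (Seq (SetNum one 1)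
  (Seq build_hom
  (Seq build_id
  (Seq (for_loop cI (IVar cM) gs_body)
  (Seq (SetCtr cK c0)
  (Seq update
  (Seq iterate
  (Seq find
       (If (CtrLt (IVar cK) (IVar cN1)) emit_certificate emit_solution)))))))))).

(** For n = 0, full row rank forces m = 0 and the empty vector is a solution. *)
Definition main : program := If (CtrLt c0 (IVar cN)) solver Skip.

(** * Correctness of the orthogonalization phase *)

Section Correctness.
Variables (R : realType) (m n : nat) (A : 'M[int]_(m, n)) (b : 'cV[int]_m).
Variable u : 'cV[R]_n.
Hypotheses (u0 : forall i, 0 < u i 0) (fA : row_free (map_mx intr A : 'M[R]_(m, n))).
Implicit Types s : state R.

Local Notation H := (pht A b u).
Local Notation B := (hom_mx A b u).
Local Notation Z := (H 16).

(** The part of the state that stays constant once B is built. Later programs preserve it by their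
    write sets, which [env_frame] checks by computation. *)
Definition env s : Prop :=
  [/\ [/\ ctr s cM = m, ctr s cN = n & ctr s cN1 = n.+1],
      mem s 14 0%N 0%N = 1, mem s 15 0%N 0%N = 0, mem s aU = store_mx u &
      forall i c, (i < m)%N -> (c <= n)%N -> mem s aB i c = hom_fun A b u i c].

Lemma env_frame P s s' : frame P s s' ->
  all (fun x => x \notin wctr P) [:: cM; cN; cN1] ->
  all (fun a => a \notin wmem P) [:: 14%N; 15%N; aU; aB] -> env s -> env s'.
Proof.
move=> [fc fm] /and4P[c1 c2 c3 _] /and5P[m1 m2 m3 m4 _] [[e1 e2 e3] e4 e5 e6 e7].
by split; rewrite ?fm //; split; rewrite fc.
Qed.

Definition projm s : 'M[R]_n.+1 := load_mx n.+1 n.+1 (mem s aProj).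
Definition multm s : 'M[R]_(m, n.+1) := load_mx m n.+1 (mem s aMult).

Lemma row_dot_load k (f : nat -> nat -> R) (i : 'I_m) s (r : 'I_k) : env s ->
  \sum_(c < n.+1) f r c * mem s aB i c = (load_mx k n.+1 f *m (row i B)^T) r 0.
Proof.
move=> [_ _ _ _ eB]; rewrite mxE; apply: eq_bigr => c _; rewrite !mxE.
by rewrite eB // -ltnS.
Qed.

(** Within one round the height exponents rise from 6 for matrix entries to 9 for q, 12 for delta,
    13 for q^T / delta and 15 for the updated entries. The invariant then brings them back to 6
    through [proj_height] and [mult_height], so nothing accumulates over the rows. *)
Lemma gs_body_spec (i : 'I_m) s : env s -> ctr s cI = i ->
  gs_inv B i (projm s) (multm s) ->
  runs Z gs_body s
    (n.+1 * (n.+1 * 2) + (m * (n.+1 * 2) + (1 + (1 * (n.+1 * 2) + (n.+1 +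
      (n.+1 * (n.+1 * 2) + m * (n.+1 * 2)))))))
    (n.+1 * (n.+1 * 4 + 5) + 2 + (m * (n.+1 * 4 + 5) + 2 + (1 +
      (1 * (n.+1 * 4 + 5) + 2 + (n.+1 * 3 + 2 + (n.+1 * (n.+1 * 4 + 5) + 2 +
        (m * (n.+1 * 4 + 5) + 2)))))))
    (fun s' => gs_inv B i.+1 (projm s') (multm s')).
Proof.
move=> es ci inv; have [[em en eN] e1 e0 eu eB] := es.
have Pe r c : (r < n.+1)%N -> (c < n.+1)%N -> H 6 (mem s aProj r c).
  by move=> rn cn; have := proj_height u0 fA inv (Ordinal rn) (Ordinal cn); rewrite mxE.
have Ve r c : (r < m)%N -> (c < n.+1)%N -> H 6 (mem s aMult r c).
  by move=> rn cn; have := mult_height u0 fA inv (Ordinal rn) (Ordinal cn); rewrite mxE.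
have Be c : (c < n.+1)%N -> H 6 (mem s aB i c).
  by move=> cn; have := @hom_height _ _ _ A b u i (Ordinal cn); rewrite mxE eB.

have Zle k x : (k <= 16)%N -> H k x -> Z x by apply: pht_le.
set q := gs_col B i (projm s); set y := gs_mult B i (multm s).
set d := (row i B *m q) 0 0; have d0 : d != 0.
  have := gs_pivot (hom_mx_free b u0 fA) inv; rewrite -mulmxA; exact.
have qE (r : 'I_n.+1) : q r 0 = \sum_(c < n.+1) mem s aProj r c * mem s aB i c.
  by rewrite (row_dot_load _ _ _ es).
have sumP r k : (r < n.+1)%N -> (k <= n.+1)%N ->
    H 9 (\sum_(c < k) mem s aProj r c * mem s aB i c).
  move=> rn kn; apply: pht_sum => // c; apply: (phtM (k := 6) (l := 6)).
    by apply: Pe => //; apply: leq_trans kn.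
  by apply: Be; apply: leq_trans kn.
have sumV r k : (r < m)%N -> (k <= n.+1)%N ->
    H 9 (\sum_(c < k) mem s aMult r c * mem s aB i c).
  move=> rn kn; apply: pht_sum => // c; apply: (phtM (k := 6) (l := 6)).
    by apply: Ve => //; apply: leq_trans kn.
  by apply: Be; apply: leq_trans kn.
have Hq (r : 'I_n.+1) : H 9 (q r 0) by rewrite qE; apply: sumP.
apply: runs_seq.
have := @matvec_spec R Z aQ aProj (IVar cN1) n.+1 n.+1 s eN eN isT isT isT.
rewrite ci => /= S1; apply: runs_post (S1 _ _) _ => {S1} [r c rn cn|r c rn cn|s1 F1 Q1].
- by apply: (Zle 7%N) => //; apply: (phtM (k := 6) (l := 6)); [exact: Pe|exact: Be].
- by apply: (Zle 9%N) => //; apply: sumP.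
have es1 := env_frame F1 isT isT es.
have {}Q1 (r : 'I_n.+1) : mem s1 aQ 0 r = q r 0 by rewrite Q1 // -qE.
have [[em1 en1 eN1] _ _ _ eB1] := es1.
have [c1 m1] := F1; have ci1 : ctr s1 cI = i by rewrite c1.
have B1 : mem s1 aB = mem s aB by rewrite m1.
apply: runs_seq.
have := @matvec_spec R Z aY aMult (IVar cM) m n.+1 s1 em1 eN1 isT isT isT.
rewrite ci1 B1 m1 // => /= S2; apply: runs_post (S2 _ _) _ => {S2} [r c rn cn|r c rn cn|s2 F2 Q2].
- by apply: (Zle 7%N) => //; apply: (phtM (k := 6) (l := 6)); [exact: Ve|exact: Be].
- by apply: (Zle 9%N) => //; apply: sumV.
have es2 := env_frame F2 isT isT es1.
have [c2 m2] := F2; have ci2 : ctr s2 cI = i by rewrite c2.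
have [_ o2 _ _ _] := es2.
have Hy r : (r < m)%N -> H 9 (mem s2 aY 0 r) by move=> rm; rewrite Q2 //; apply: sumV.
apply: runs_seq; apply: runs_arith => //=.
  rewrite ci2 o2; apply: (Zle 10%N) => //; apply: (phtD (k := 9) (l := 9)); last exact: pht1.
  exact: Hy.
rewrite ci2 o2; set s3 := State _ _.
have yE (r : 'I_m) : mem s3 aY 0 r = y r 0.
  rewrite /= mxE -(row_dot_load (mem s aMult) i r es) -(Q2 r (ltn_ord r)) [in RHS]mxE andbT.
  by rewrite (inj_eq val_inj); case: eqP => [->|_]; rewrite ?addr0.
have F3 : frame (Arith (Cell aY c0 (IVar cI)) OpAdd (Cell aY c0 (IVar cI)) one) s2 s3.
  by split=> // a; rewrite inE => /= /negbTE->.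
have es3 := env_frame F3 isT isT es2.
have Hy3 (r : 'I_m) : H 10 (y r 0).
  rewrite -yE /= ; case: ifP => _; last by apply: (@pht_le _ _ _ _ _ _ 9); [|exact: Hy].
  by apply: (phtD (k := 9) (l := 9)); [exact: Hy|exact: pht1].
have [[em3 en3 eN3] _ _ _ _] := es3.
have ci3 : ctr s3 cI = i by [].
have q3 (r : 'I_n.+1) : mem s3 aQ 0 r = q r 0 by rewrite /= m2 // Q1.
have B3 : mem s3 aB = mem s aB by rewrite /= m2.
have dE : \sum_(c < n.+1) mem s3 aQ 0 c * mem s aB i c = d.
  by rewrite /d mxE; apply: eq_bigr => c _; rewrite q3 mulrC !mxE eB // -ltnS.
have Hqb k : (k <= n.+1)%N -> H 12 (\sum_(c < k) mem s3 aQ 0 c * mem s aB i c).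
  move=> kn; apply: pht_sum => // c; apply: (phtM (k := 9) (l := 6)).
    by have := Hq (widen_ord kn c); rewrite -q3.
  by apply: Be; apply: leq_trans kn.
apply: runs_seq.
have := @matvec_spec R Z aDelta aQ (ICst 1) 1 n.+1 s3 erefl eN3 isT isT isT.
rewrite ci3 B3 => S4; apply: runs_post (S4 _ _) _ => {S4} [[|//] c _ cn|[|//] c _ cn|s4 F4 Q4].
- apply: (Zle 10%N) => //; apply: (phtM (k := 9) (l := 6)); last exact: Be.
  by have := Hq (Ordinal cn); rewrite -q3.
- by apply: (Zle 12%N) => //; apply: Hqb.
have es4 := env_frame F4 isT isT es3.
have [[em4 en4 eN4] _ _ _ _] := es4.
have {}Q4 : mem s4 aDelta 0 0 = d by rewrite Q4.
have [c4 m4] := F4.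
have q4 (r : 'I_n.+1) : mem s4 aQ 0 r = q r 0 by rewrite m4.
pose e (c : 'I_n.+1) := q c 0 / d.
have He c : H 13 (e c).
  by apply: (pht_div (k := 9) (l := 12)); [exact: Hq|rewrite -dE; exact: Hqb].
apply: runs_seq.
have := @scale_dual_spec R Z n.+1 s4 eN4.
rewrite /get /= Q4 => S5; apply: runs_post (S5 d0 _) _ => {S5} [c cn|s5 F5 Q5].
  by apply: (Zle 13%N) => //; have := He (Ordinal cn); rewrite /e -q4.
have es5 := env_frame F5 isT isT es4.
have [[em5 en5 eN5] _ _ _ _] := es5.
have [c5 m5] := F5.
have {}Q5 (c : 'I_n.+1) : mem s5 aDual 0 c = e c by rewrite Q5 // q4.
have q5 (r : 'I_n.+1) : mem s5 aQ 0 r = q r 0 by rewrite m5.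
have y5 (r : 'I_m) : mem s5 aY 0 r = y r 0 by rewrite m5 // m4.
have P5 : mem s5 aProj = mem s aProj by rewrite m5 // m4 //= m2 // m1.
have V5 : mem s5 aMult = mem s aMult by rewrite m5 // m4 //= m2 // m1.
apply: runs_seq.
have := @rank_one_spec R Z aProj aQ (IVar cN1) n.+1 n.+1 s5 eN5 eN5 isT isT isT.
rewrite P5 => S6; apply: runs_post (S6 _ _) _ => {S6} [r c rn cn|r c rn cn|s6 F6 Q6].
- rewrite (q5 (Ordinal rn)) (Q5 (Ordinal cn)).
  by apply: (Zle 14%N) => //; apply: (phtM (k := 9) (l := 13)).
- rewrite (q5 (Ordinal rn)) (Q5 (Ordinal cn)).
  apply: (Zle 15%N) => //; apply: (phtB (k := 6) (l := 14)); first exact: Pe.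
  by apply: (phtM (k := 9) (l := 13)).
have es6 := env_frame F6 isT isT es5.
have [[em6 en6 eN6] _ _ _ _] := es6.
have [c6 m6] := F6.
have {}Q6 (r c : 'I_n.+1) : mem s6 aProj r c = mem s aProj r c - q r 0 * e c.
  by rewrite Q6 // q5 Q5.
have y6 (r : 'I_m) : mem s6 aY 0 r = y r 0 by rewrite m6.
have e6 (c : 'I_n.+1) : mem s6 aDual 0 c = e c by rewrite m6.
have := @rank_one_spec R Z aMult aY (IVar cM) m n.+1 s6 em6 eN6 isT isT isT.
rewrite m6 // V5 => S7; apply: runs_post (S7 _ _) _ => {S7} [r c rn cn|r c rn cn|s7 F7 Q7].
- rewrite (y6 (Ordinal rn)) (e6 (Ordinal cn)).
  by apply: (Zle 14%N) => //; apply: (phtM (k := 10) (l := 13)).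
- rewrite (y6 (Ordinal rn)) (e6 (Ordinal cn)).
  apply: (Zle 15%N) => //; apply: (phtB (k := 6) (l := 14)); first exact: Ve.
  by apply: (phtM (k := 10) (l := 13)).
have dualE c : gs_dual B i (projm s) 0 c = e c.
  by rewrite /gs_dual mxE [X in _ * X]mxE mulrC.
have -> : projm s7 = projm s - gs_col B i (projm s) *m gs_dual B i (projm s).
  apply/matrixP=> r c; rewrite mxE (F7.2 aProj isT) Q6 [RHS]mxE [X in _ = X + _]mxE.
  by rewrite [X in _ = _ + X]mxE [X in _ = _ - X]mxE big_ord1 dualE.
have -> : multm s7 = multm s - gs_mult B i (multm s) *m gs_dual B i (projm s).
  apply/matrixP=> r c; rewrite mxE Q7 // y6 e6 [RHS]mxE [X in _ = X + _]mxE.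
  by rewrite [X in _ = _ + X]mxE [X in _ = _ - X]mxE big_ord1 dualE.
exact: gs_step (hom_mx_free b u0 fA) inv.
Qed.

(** * Correctness of the perceptron phase *)

Definition zvec (z : nat -> nat) : 'cV[R]_n.+1 := \col_k (z k)%:R.

Definition bump (k : nat) (z : nat -> nat) : nat -> nat := fun j => (z j + (j == k))%N.

Lemma zvec_bump (k : 'I_n.+1) z : zvec (bump k z) = zvec z + delta_mx k 0.
Proof. by apply/colP=> j; rewrite !mxE natrD andbT. Qed.

Lemma sum_bump (k : 'I_n.+1) z :
  (\sum_(j < n.+1) bump k z j = (\sum_(j < n.+1) z j).+1)%N.
Proof.
rewrite big_split /= -[RHS]addn1; congr (_ + _)%N.
by rewrite (bigD1 k) //= eqxx big1 // => j /negbTE; rewrite -(inj_eq val_inj) => ->.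
Qed.

Definition good s : Prop :=
  0 < mem s aP n 0%N /\ forall r, (r < n)%N -> 0 <= mem s aP r 0%N.

(** When an index is found, [~ good] is recorded as well, since it rules out the second alternative
    of [perc]. *)
Lemma find_spec s : env s ->
  runs Z find s (n + 1) (n * 4 + 5) (fun s' =>
    ((ctr s' cK < n.+1)%N -> mem s' aP (ctr s' cK) 0%N <= 0 /\ ~ good s') /\
    ((n < ctr s' cK)%N -> good s')).
Proof.
move=> es; have [[em en eN] _ e0 _ _] := es.
apply: (@runs_weaken _ _ _ _ (0 + (1 + 0 + n * (1 + 0))) (1 + (2 + (n * (2 + 2) + 2)))
  _ _ _ _ _ _ _ (fun s' _ => id)); [|lia|lia].
apply: runs_seq; apply: runs_setctr => /=; rewrite eN; set s1 := put_ctr _ _ _.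
apply: runs_seq.
apply: runs_post (_ : runs _ _ s1 _ _ (fun s2 =>
    ((ctr s2 cK < n.+1)%N -> mem s2 aP (ctr s2 cK) 0%N <= 0 /\ ~ good s2) /\
    ((n < ctr s2 cK)%N -> 0 < mem s2 aP n 0%N))) _.
  apply: runs_if => /=; rewrite en e0 => pn.
    apply: runs_setctr; rewrite /= en ltnn; split=> // _; split=> // -[].
    by rewrite /= ltNge pn.
  apply: (runs_weaken (runs_skip _ _)) (leqnn 0) (leq0n 1) (fun _ _ => id).
  by rewrite /= ltnn ltNge.
move=> s2 F2 [I1 I2].
have es2 : env s2 by apply: env_frame F2 isT isT _.
have [[em2 en2 eN2] _ e02 _ _] := es2.
apply: (@runs_for _ _ _ _ _ s2 n _ _ (fun k s' =>
    ((ctr s' cK < n.+1)%N -> mem s' aP (ctr s' cK) 0%N <= 0 /\ ~ good s') /\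
    ((n < ctr s' cK)%N -> 0 < mem s' aP n 0%N /\
       forall r, (r < k)%N -> 0 <= mem s' aP r 0%N))) => //.
  by split=> // /I2.
move=> k s3 kn ck F3 [J1 J2].
have es3 : env s3 by apply: env_frame F3 isT isT _.
have [_ _ e03 _ _] := es3.
apply: runs_if => /=; rewrite ck e03 => pk.
  apply: (runs_weaken (runs_skip _ _)) (leqnn 0) (leq0n 1) (fun _ _ => id).
  split=> // /J2[pn J]; split=> // r /=; rewrite ltnS leq_eqVlt => /orP[/eqP->//|]; exact: J.
apply: runs_setctr; rewrite /= ck; split=> [_|].
  by split; [rewrite ltW // ltNge | case=> _ /(_ _ kn); exact/negP].
by rewrite ltnNge ltnW.
Qed.

Section Iteration.
Variables (P : 'M[R]_n.+1) (V : 'M[R]_(m, n.+1)).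
Hypothesis inv : gs_inv B m P V.

Definition pstate z s : Prop :=
  [/\ env s, projm s = P /\ multm s = V,
      forall k, (k < n.+1)%N -> mem s aZ k 0%N = (z k)%:R,
      forall r : 'I_n.+1, mem s aP r 0%N = (P *m zvec z) r 0 &
      forall r : 'I_m, mem s aV r 0%N = (V *m zvec z) r 0].

Lemma pstate_frame z Q s s' : frame Q s s' ->
  all (fun x => x \notin wctr Q) [:: cM; cN; cN1] ->
  all (fun a => a \notin wmem Q)
    [:: 14%N; 15%N; aU; aB; aProj; aMult; aZ; aP; aV] -> pstate z s -> pstate z s'.
Proof.
move=> F wc /and5P[w1 w2 w3 w4 /and5P[w5 w6 w7 w8 /andP[w9 _]]] [es [eP eV] hz hp hv].
have [_ fm] := F.
split; [|by rewrite /projm /multm !fm|by rewrite fm|by rewrite fm|by rewrite fm].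
by apply: env_frame F wc _ es; rewrite /= w1 w2 w3 w4.
Qed.

Lemma comb_height k (M : 'M[R]_(k, n.+1)) z r :
  (forall i j, H 6 (M i j)) -> (forall j, (j < n.+1)%N -> (z j <= 8 * n ^ 3 + 1)%N) ->
  H 9 ((M *m zvec z) r 0).
Proof.
move=> hM hz; rewrite mxE; apply: pht_sum => // j.
by apply: (phtM (k := 6) (l := 5)); rewrite // mxE; apply: pht_count; apply: hz.
Qed.

(** P (z + e_k) is P z plus column k of P, and likewise for V. An increment thus costs O(m + n)
    operations, so O(n^3) of them fit in O(n^4). Heights are derived afresh from z and do not build
    up. *)
Lemma update_spec z s (k : 'I_n.+1) : pstate z s -> ctr s cK = k ->
  (forall j, (j < n.+1)%N -> (bump k z j <= 8 * n ^ 3 + 1)%N) ->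
  runs Z update s (1 + (n.+1 + m)) (1 + (n.+1 * 3 + 2 + (m * 3 + 2)))
    (pstate (bump k z)).
Proof.
move=> ps ck hz; have [es [eP eV] pz pp pv] := ps.
have [[em en eN] e1 _ _ _] := es.
have Zle l x : (l <= 16)%N -> H l x -> Z x by apply: pht_le.
have zk : (z k)%:R + 1 = (bump k z k)%:R :> R by rewrite /bump eqxx natrD.
apply: runs_seq; apply: runs_arith => //=.
  by rewrite ck e1 pz // zk; apply: (Zle 5%N) => //; apply: pht_count; apply: hz.
rewrite ck e1 pz // zk; set s1 := State _ _.
have F1 : frame (Arith (Cell aZ (IVar cK) c0) OpAdd (Cell aZ (IVar cK) c0) one) s s1.
  by split=> // a; rewrite inE => /= /negbTE->.
have es1 := env_frame F1 isT isT es.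
have z1 j : (j < n.+1)%N -> mem s1 aZ j 0 = (bump k z j)%:R.
  by move=> jn; rewrite /= andbT; case: eqP => [->//|/eqP/negbTE jk]; rewrite pz // /bump jk addn0.
have [[em1 en1 eN1] _ _ _ _] := es1.
have colE' l (f : nat -> nat -> R) (r : 'I_l) (M : 'M[R]_(l, n.+1)) :
    load_mx l n.+1 f = M -> (M *m zvec z) r 0 + f r k = (M *m zvec (bump k z)) r 0.
  by move=> <-; rewrite zvec_bump mulmxDr [RHS]mxE -colE !mxE.
apply: runs_seq.
have := @add_col_spec R Z aP aProj (IVar cN1) n.+1 s1 eN1 isT isT => /=; rewrite ck => S2.
have p2 (r : 'I_n.+1) : mem s aP r 0 + mem s aProj r k = (P *m zvec (bump k z)) r 0.
  by rewrite pp (colE' _ _ _ _ eP).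
apply: runs_post (S2 _) _ => {S2} [r rn|s2 F2 Q2].
  rewrite (p2 (Ordinal rn)); apply: (Zle 9%N) => //; apply: (comb_height _ _ hz).
  exact: (proj_height u0 fA inv).
have es2 := env_frame F2 isT isT es1.
have [[em2 en2 eN2] _ _ _ _] := es2.
have [c2 m2] := F2.
have := @add_col_spec R Z aV aMult (IVar cM) m s2 em2 isT isT => /=.
rewrite c2 // !m2 //= ck => S3.
have v3 (r : 'I_m) : mem s aV r 0 + mem s aMult r k = (V *m zvec (bump k z)) r 0.
  by rewrite pv (colE' _ _ _ _ eV).
apply: runs_post (S3 _) _ => {S3} [r rm|s3 F3 Q3].
  rewrite (v3 (Ordinal rm)); apply: (Zle 9%N) => //; apply: (comb_height _ _ hz).
  exact: (mult_height u0 fA inv).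
have [c3 m3] := F3; split.
- exact: env_frame F3 isT isT es2.
- by rewrite /projm /multm !m3 // !m2.
- by move=> j jn; rewrite m3 // m2 // z1.
- by move=> r; rewrite m3 // Q2 // p2.
- by move=> r; rewrite Q3 // v3.
Qed.

(** The count is j + 1 because of the initial increment. Once p is good the rounds idle, so the
    total is then only bounded above, which still controls the heights. *)
Definition perc (j : nat) s : Prop := exists z,
  [/\ pstate z s, (0 < z 0)%N, (\sum_(k < n.+1) z k <= j.+1)%N &
      (\sum_(k < n.+1) z k = j.+1 /\ quad P (zvec z) <= j.+1%:R) \/ good s].

Lemma gs_projection : P^T = P /\ P *m P = P.
Proof. by split; [case: inv | exact: gs_idem inv]. Qed.

Lemma step_spec j s : (j.+1 <= 8 * n ^ 3)%N -> perc j s ->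
  runs Z step s (n + 1 + (0 + (1 + (n.+1 + m))))
    (n * 4 + 5 + (1 + (n.+1 * 3 + 2 + (m * 3 + 2))).+1) (perc j.+1).
Proof.
move=> jJ [z [ps z0 sz hz]]; have [es _ _ _ _] := ps.
apply: runs_seq; apply: runs_post (find_spec es) _ => s1 F1 [I1 I2].
have ps1 : pstate z s1 by apply: pstate_frame F1 isT isT ps.
have [es1 _ _ pp1 _] := ps1; have [[em1 en1 eN1] _ _ _ _] := es1.
apply: runs_if => /=; rewrite eN1 => kn; last first.
  apply: (runs_weaken (runs_skip _ _)) (leq0n _) (leq0n _) (fun _ _ => id).
  exists z; split=> //; first exact: leqW.
  by right; apply: I2; rewrite ltnNge -ltnS.
pose k := Ordinal kn.
have zj i : (i < n.+1)%N -> (bump k z i <= 8 * n ^ 3 + 1)%N.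
  move=> ilt; rewrite addn1; apply: leq_trans (_ : (\sum_(l < n.+1) bump k z l <= _)%N).
    by rewrite (bigD1 (Ordinal ilt)) //= leq_addr.
  by rewrite sum_bump ltnS; apply: leq_trans sz _.
apply: runs_post (update_spec ps1 (erefl : ctr s1 cK = k) zj) _ => s2 F2 ps2.
exists (bump k z); split=> //; first by rewrite /bump addn_gt0 z0.
  by rewrite sum_bump ltnS.
(* A good p contradicts the index returned by [find], which does not modify p. *)
case: hz => [[Ez qz]|[pn pr]]; last first.
  by have [_ []] := I1 kn; have [_ m1] := F1; rewrite /good !m1.
left; split; first by rewrite sum_bump Ez.
rewrite zvec_bump; have [sP iP] := gs_projection.
have [pk _] := I1 kn.
apply: le_trans (quad_step sP iP _) _; first by rewrite -pp1.
by rewrite -[j.+2]addn1 natrD lerD2r.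
Qed.

Lemma iterate_spec s : (0 < n)%N -> perc 0 s ->
  runs Z iterate s (n * (n * (n * (8 * (n + 1 + (0 + (1 + (n.+1 + m))))))))
    (n * (n * (n * (8 * (n * 4 + 5 + (1 + (n.+1 * 3 + 2 + (m * 3 + 2))).+1 + 2) + 2 + 2)
       + 2 + 2) + 2 + 2) + 2)
    (perc (8 * n ^ 3)).
Proof.
move=> n0 h0.
have pctr j s' (x k : nat) : x \notin [:: cM; cN; cN1] -> perc j s' -> perc j (put_ctr s' x k).
  rewrite !inE !negb_or => /and3P[x1 x2 x3] [z [[es e1 e2 e3 e4] h1 h2 h3]]; exists z; split=> //.
  split=> //; have [[e5 e6 e7] ? ? ? ?] := es; split=> //.
  by split=> /=; rewrite eq_sym ?(negbTE x1) ?(negbTE x2) ?(negbTE x3).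
have en j s' : perc j s' -> ctr s' cN = n by move=> [z [[[[]]]]].
have -> : (8 * n ^ 3 = 0 + n * (n * (n * (8 * 1))))%N by rewrite !expnS; lia.
apply: (@runs_for_mul _ _ 8 (IVar cN) _ n (n * (n * (8 * 1))) (8 * n ^ 3) _ _ perc) => //.
  apply: (@runs_for_mul _ _ 9 (IVar cN) _ n (n * (8 * 1)) (8 * n ^ 3) _ _ perc) => //.
  apply: (@runs_for_mul _ _ 10 (IVar cN) _ n (8 * 1) (8 * n ^ 3) _ _ perc) => //.
  apply: (@runs_for_mul _ _ 11 (ICst 8) _ 8 1 (8 * n ^ 3) _ _ perc) => //.
  by move=> j s' jJ hj; rewrite [(j + 1)%N]addn1; apply: step_spec hj; rewrite -addn1.
by rewrite !expnS; lia.
Qed.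

End Iteration.

(** * Output and the complete run *)

Lemma emit_solution_spec s : env s -> good s ->
  (forall r, (r < n.+1)%N -> H 9 (mem s aP r 0%N)) ->
  runs Z emit_solution s (n * (1 + 1)) (n * (1 + 1 + 2) + 2) (fun s' =>
    forall r, (r < n)%N ->
      mem s' aX r 0%N = store_mx u r 0%N * (mem s aP r 0%N / mem s aP n 0%N)).
Proof.
move=> es [pn pr] hp; have [[em en eN] _ _ eu _] := es.
apply: (@runs_for _ _ _ _ _ s n _ _ (fun k s' => forall r, (r < k)%N ->
  mem s' aX r 0%N = store_mx u r 0%N * (mem s aP r 0%N / mem s aP n 0%N))) => //.
move=> k s1 kn ck [fc fm] I; have cn1 : ctr s1 cN = n by rewrite fc.
have hk : H 10 (mem s aP k 0%N / mem s aP n 0%N).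
  by apply: (pht_div (k := 9) (l := 9)); apply: hp => //; apply: ltnW.
apply: runs_seq; apply: runs_arith => /= [_||]; rewrite cn1 ?ck !fm //.
- by rewrite gt_eqF.
- exact: pht_le hk.
apply: runs_arith => //=; rewrite ck fm // eu.
  apply: (@pht_le _ _ _ _ _ _ 11) => //; apply: (phtM (k := 1) (l := 10)) hk.
  by have := @pht_input _ _ _ A b u (Ordinal kn); rewrite -store_mxE.
move=> r rk /=; rewrite andbT; case: eqP => [->//|/eqP rk']; apply: I.
by rewrite ltn_neqAle rk' -ltnS.
Qed.

Lemma emit_certificate_spec s : env s ->
  (forall r, (r < n.+1)%N -> H 5 (mem s aZ r 0%N)) ->
  runs Z emit_certificate s (0 + n * 1) (1 + (n * (1 + 2) + 2)) (fun s' =>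
    ctr s' cOut = 1%N /\
    forall r, (r < n)%N -> mem s' aZ r 0%N = mem s aZ r 0%N / store_mx u r 0%N).
Proof.
move=> es hz; have [[em en eN] _ _ eu _] := es.
apply: runs_seq; apply: runs_setctr => /=; set s1 := put_ctr _ _ _.
apply: runs_post (_ : runs _ _ s1 _ _ (fun s' => forall r, (r < n)%N -> mem s' aZ r 0%N =
  if (r < n)%N then mem s aZ r 0%N / store_mx u r 0%N else mem s aZ r 0%N)) _; last first.
  move=> s' [fc _] I; rewrite fc //; split=> // r rn; by rewrite I // rn.
apply: (@runs_for _ _ _ _ _ s1 n _ _ (fun k s' => forall r, (r < n)%N -> mem s' aZ r 0%N =
  if (r < k)%N then mem s aZ r 0%N / store_mx u r 0%N else mem s aZ r 0%N)) => //.
move=> k s2 kn ck [fc fm] I.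
have uk : store_mx u k 0 = u (Ordinal kn) 0 by rewrite -[RHS]store_mxE.
have E : mem s2 aZ k 0 / mem s2 aU k 0 = mem s aZ k 0 / store_mx u k 0.
  by rewrite I // ltnn fm //= eu.
apply: runs_arith => /= [_||]; rewrite ck ?E.
- by rewrite fm //= eu uk gt_eqF.
- apply: (@pht_le _ _ _ _ _ _ 6) => //; apply: (pht_div (k := 5) (l := 1)).
    by apply: hz; apply: ltnW.
  by rewrite uk; apply: pht_input.
move=> r rn /=; rewrite andbT; case: eqP => [->|/eqP/negbTE rk']; first by rewrite ltnSn.
by rewrite I // ltnS [(r <= k)%N]leq_eqVlt rk'.
Qed.

Lemma solver_spec : (0 < n)%N -> exists a t,
  [/\ runs Z solver (input A b u) a t (fun s' => valid_outcome A b u (output m n s')),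
     (a <= 500 * n ^ 4)%N & (t <= 2000 * n.+1 ^ 4)%N].
Proof.
move=> n0.
have mn : (m <= n)%N by move: fA; rewrite /row_free => /eqP <-; exact: rank_leq_col.
(* The two costs are left as unknowns, filled in by the sequence of rules below and estimated at the
   end. *)
do 2 eexists; split.
apply: runs_seq; apply: runs_setctr; apply: runs_seq; apply: runs_incrctr.
apply: runs_seq; apply: runs_setnum => /=.
set s1 := State _ _.
have e1 : ctr s1 cN1 = n.+1 by [].
apply: runs_seq.
have S2 := @build_hom_spec R Z m n s1 erefl erefl erefl.
apply: runs_post (S2 _) _ => {S2} [i c im cn|s2 F2 Q2].
  have := @hom_height _ _ _ A b u (Ordinal im) (Ordinal (cn : (c < n.+1)%N)).
  by rewrite mxE; apply: pht_le.
have es2 : env s2.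
  have [fc fm] := F2; split; [by split; rewrite fc|by rewrite fm|by rewrite fm|by rewrite fm|exact: Q2].
have [[em2 en2 eN2] _ _ _ _] := es2.
have [c2 m2] := F2.
apply: runs_seq.
have S3 := @build_id_spec R Z n.+1 s2 eN2.
apply: runs_post (S3 _) _ => {S3} [i j|s3 F3 Q3]; first by rewrite m2.
have es3 := env_frame F3 isT isT es2.
have [[em3 en3 eN3] _ _ _ _] := es3.
have [c3 m3] := F3.
have inv3 : gs_inv B 0 (projm s3) (multm s3).
  have -> : projm s3 = 1%:M by apply/matrixP=> i j; rewrite !mxE Q3.
  have -> : multm s3 = 0 by apply/matrixP=> i j; rewrite !mxE m3 // m2.
  exact: gs_inv0.
apply: runs_seq.
apply: runs_post (_ : runs _ _ s3 _ _ (fun s' => gs_inv B m (projm s') (multm s'))) _.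
  apply: (@runs_for _ _ _ _ _ s3 m _ _ (fun i s' => gs_inv B i (projm s') (multm s'))) => //.
  move=> i s' im ci F' Ii.
  have es' : env s' by apply: env_frame F' isT isT _.
  exact: (@gs_body_spec (Ordinal im) s' es' ci Ii).
move=> s4 F4 inv4.
have es4 := env_frame F4 isT isT es3.
have [[em4 en4 eN4] _ _ _ _] := es4.
have [c4 m4] := F4.
apply: runs_seq; apply: runs_setctr => /=; set s5 := put_ctr _ _ _.
have Z0 a : a \in [:: aZ; aP; aV] -> mem s5 a = fun _ _ => 0.
  by rewrite !inE => /or3P[]/eqP->; rewrite /= m4 // m3 // m2.
pose z0 : nat -> nat := fun=> 0%N.
have zv0 : zvec z0 = 0 by apply/colP=> j; rewrite !mxE.
have ps5 : pstate (projm s4) (multm s4) z0 s5.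
  split=> //.
  - by move=> k _; rewrite Z0.
  - by move=> r; rewrite Z0 // zv0 mulmx0 mxE.
  - by move=> r; rewrite Z0 // zv0 mulmx0 mxE.
set P := projm s4 in inv4 ps5 *; set V := multm s4 in inv4 ps5 *.
have [sP iP] := gs_projection inv4.
apply: runs_seq.
apply: runs_post (update_spec inv4 ps5 (erefl : ctr s5 cK = (ord0 : 'I_n.+1)) _) _ => [j _|s6 F6 ps6].
  by rewrite /bump /z0 add0n (leq_trans (leq_b1 _)) // addn1.
have sum1 : (\sum_(k < n.+1) bump 0 z0 k = 1)%N.
  by rewrite (sum_bump ord0) big1.
have perc6 : perc P V 0 s6.
  exists (bump 0 z0); split=> //; first by rewrite sum1.
  left; split=> //; rewrite (zvec_bump ord0) zv0 add0r.
  exact: quad_delta_le1.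
apply: runs_seq.
apply: runs_post (iterate_spec inv4 n0 perc6) _ => s7 F7 [z [ps7 zpos zsum zq]].
have [es7 _ _ _ _] := ps7.
apply: runs_seq.
apply: runs_post (find_spec es7) _ => s8 F8 [I1 I2].
have ps8 : pstate P V z s8 by apply: pstate_frame F8 isT isT ps7.
have [es8 [eP8 eV8] z8 p8 v8] := ps8.
have [[em8 en8 eN8] _ _ eu8 _] := es8.
have zle j : (j < n.+1)%N -> (z j <= 8 * n ^ 3 + 1)%N.
  move=> jn; rewrite addn1; apply: leq_trans zsum.
  by rewrite (bigD1 (Ordinal jn)) //= leq_addr.
pose pv : 'cV[R]_n.+1 := P *m zvec z.
have out8 : ctr s8 cOut = 0%N.
  have [c5 _] := F6; have [c7 _] := F7; have [c8 _] := F8.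
  by rewrite c8 // c7 // c5 //= c4 // c3 // c2.
apply: runs_if => /=; rewrite eN8 => kn.
  (* Both output branches are given the same budget, as the conditional requires. *)
  apply: (@runs_weaken _ _ _ _ _ _ (n * 2) (n * 4 + 3) _ _ (emit_certificate_spec es8 _)) => [r rn|||s9 F9 [o9 z9]]; [|lia|lia|].
    by rewrite z8 //; apply: pht_count; apply: zle.
  have [_ ngood] := I1 kn.
  have [Ez qz] : (\sum_(k < n.+1) z k)%N = (8 * n ^ 3).+1%N /\ quad P (zvec z) <= (8 * n ^ 3).+1%:R.
    case: zq => // g7; case: ngood; move: g7; rewrite /good.
    by have [_ m8] := F8; rewrite m8.
  have EK : \sum_j zvec z j 0 = (8 * n ^ 3).+1%:R :> R.
    by rewrite -Ez natr_sum; apply: eq_bigr => j _; rewrite mxE.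
  rewrite /output o9 /=.
  have [_ m9] := F9.
  have -> : load_mx m 1 (mem s9 aV) = V *m zvec z.
    by apply/colP=> r; rewrite mxE m9 //= v8.
  have -> : load_mx n 1 (mem s9 aZ) =
      \col_j (zvec z (widen_ord (leqnSn n) j) 0 / u j 0).
    apply/colP=> j; rewrite !mxE z9 // (z8 j (leqW (ltn_ord j))).
    by rewrite -[0%N]/(nat_of_ord (0 : 'I_1)) store_mxE.
  apply: (@certificate_valid _ _ _ A b u u0 (zvec z) pv) => //.
  - have [_ eP _ _] := inv4.
    by rewrite /pv {1}eP mulmxDl mul1mx mulmxA.
  - by move=> j; rewrite mxE ler0n.
  - by rewrite mxE ltr0n.
  - by rewrite EK; move: qz; rewrite (quadE sP iP).
  (* 4 n^2 (n + 1) <= 8 n^3 for n >= 1, with equality at n = 1; the initial unit of weight in K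
     makes the inequality strict. *)
  - rewrite EK ltr_nat ltnS !expnS expn0; nia.
have g8 : good s8 by apply: I2; rewrite ltnNge -ltnS.
apply: (@runs_weaken _ _ _ _ _ _ (n * 2) (n * 4 + 3) _ _ (emit_solution_spec es8 g8 _)) => [r rn|||s9 F9 x9]; [|lia|lia|].
  rewrite (p8 (Ordinal rn)); apply: (comb_height _ _ zle).
  exact: (proj_height u0 fA inv4).
have [pn pr] := g8; have [c9 _] := F9.
rewrite /output c9 // out8 /=.
have -> : load_mx n 1 (mem s9 aX) =
    \col_j (u j 0 * (pv (widen_ord (leqnSn n) j) 0 / pv ord_max 0)).
  apply/colP=> j; rewrite mxE [RHS]mxE x9 //.
  rewrite -[X in store_mx _ _ X]/(nat_of_ord (0 : 'I_1)) store_mxE.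
  by rewrite -(p8 (widen_ord (leqnSn n) j)) -(p8 ord_max).
apply: solution_valid => //.
- have [_ _ _ BP] := inv4; apply/row_matrixP=> i; rewrite row_mul mulmxA BP // mul0mx row0 //.
- by move=> j; rewrite /pv -(p8 (widen_ord (leqnSn n) j)); apply: (pr j (ltn_ord j)).
- by rewrite /pv -(p8 ord_max).
(* By m <= n, each monomial of the costs involving m is bounded by a power of n. *)
all: rewrite /= !expnS expn0.
all: have h1 : (m * n <= n * n)%N by rewrite leq_mul.
all: have h2 : (m * n * n <= n * n * n)%N by rewrite leq_mul.
all: have h3 : (m * m * n <= n * n * n)%N by rewrite !leq_mul.
all: have h4 : (m * n * n * n <= n * n * n * n)%N by rewrite !leq_mul.
all: have h5 : (m * m <= n * n)%N by rewrite leq_mul.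
all: have g1 : (n <= n * n)%N by rewrite leq_pmulr.
all: have g2 : (n * n <= n * n * n)%N by rewrite leq_pmulr.
all: have g3 : (n * n * n <= n * n * n * n)%N by rewrite leq_pmulr.
all: nia.
Qed.

End Correctness.

(** * Bounds in terms of the encoding size *)

Lemma input_bound_size (R : realType) m n (A : 'M[int]_(m, n)) (b : 'cV[int]_m)
    (u : 'cV[R]_n) (uq : 'cV[rat]_n) :
  u = map_mx ratr uq -> input_bound A b u (input_size A b uq).
Proof.
move=> ->.
have entry k l (M : 'M[rat]_(k, l)) i j : (rat_size (M i j) <= mx_size M)%N.
  rewrite /mx_size (bigD1 i) //= (bigD1 j) //=; lia.
have int_entry k l (M : 'M[int]_(k, l)) i j L :
    (mx_size (map_mx intr M : 'M[rat]_(k, l)) <= L)%N -> (`|M i j| <= 2 ^ L)%N.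
  move=> ML; have := leq_trans (entry k l (map_mx intr M) i j) ML.
  rewrite mxE /rat_size numq_int => le.
  have := up_logP (`|M i j| + 1) (isT : (1 < 2)%N).
  have : (2 ^ up_log 2 (`|M i j| + 1) <= 2 ^ L)%N by rewrite leq_exp2l //; lia.
  by lia.
have rows k (M : 'cV[rat]_k) : (k <= mx_size M)%N by rewrite /mx_size muln1 leq_addr.
split.
- by move=> i j; apply: int_entry; rewrite /input_size -addnA leq_addr.
- by move=> i; apply: int_entry; rewrite /input_size addnAC leq_addl.
- by move=> j; rewrite mxE; apply: rat_size_ht; apply: leq_trans (entry _ _ _ _ _) _; rewrite leq_addl.
- split; first by apply: leq_trans (rows _ (map_mx intr b)) _; rewrite /input_size addnAC leq_addl.
  by apply: leq_trans (rows _ uq) _; rewrite leq_addl.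
Qed.

Lemma horner_nat (c d k x : nat) :
  (c%:P * ('X + d%:P) ^+ k).[x] = (c * (x + d) ^ k)%N.
Proof. by rewrite hornerM horner_exp hornerD hornerX !hornerC -natrXE. Qed.

Theorem theorem1 (R : realType) :
  exists (P : program) (C : nat) (steps_bound size_bound : {poly nat}),
  forall (m n : nat) (A : 'M[int]_(m, n)) (b : 'cV[int]_m) (u : 'cV[R]_n),
    row_free (map_mx intr A : 'M[R]_(m, n)) ->
    (forall i : 'I_n, 0 < u i 0) ->
    exists (tr : seq (event R)) (s : state R),
      [/\ exec P (input A b u) tr s,
          valid_outcome A b u (output m n s),
          (num_arith tr <= C * n ^ 4)%N,
          (num_steps tr <= steps_bound.[(m + n)%N])%N
        & forall uq : 'cV[rat]_n, u = map_mx ratr uq ->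
            forall x : R, x \in computed tr ->
              exists2 r : rat, x = ratr r
                & (rat_size r <= size_bound.[input_size A b uq])%N].
Proof.
(* 2001 is the 2000 of [solver_spec] plus one for the test in [main]. The factor 5 comes from 2 h +
   3 <= 5 h with h the height bound, which is positive. *)
exists main, 500%N, ((2001%N)%:P * ('X + (1%N)%:P) ^+ 4), ((5%N)%:P * ('X + (3%N)%:P) ^+ 16).
move=> m n A b u fA u0.
have [a [t [[tr [s [ex ha ht hz hv]]] an tn]]] : exists a t,
    [/\ runs (pht A b u 16) main (input A b u) a t
          (fun s => valid_outcome A b u (output m n s)),
      (a <= 500 * n ^ 4)%N & (t <= 2001 * n.+1 ^ 4)%N].
  case: (posnP n) => [n0|n0].
    subst n; exists 0%N, 1%N; split=> //.
    apply: runs_if => //= _; apply: runs_skip; split; last by case.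
    have m0 : m = 0%N by move: fA; rewrite /row_free => /eqP <-; apply/eqP; rewrite -leqn0 rank_leq_col.
    by subst m; apply/colP; case.
  have [a [t [hr ha ht]]] := solver_spec b u0 fA n0.
  exists (0 + a)%N, t.+1; split=> //; first by apply: runs_if => //=; rewrite n0.
  by rewrite mulSn -addn1 addnC leq_add // expn_gt0.
exists tr, s; split=> //.
- exact: leq_trans an.
- apply: leq_trans ht (leq_trans tn _); rewrite horner_nat leq_mul2l /= leq_exp2r //.
  by rewrite addn1 ltnS leq_addl.
move=> uq uE x xtr; have [r -> hr] := ht_rat (hz x xtr _ (input_bound_size A b uE)).
exists r => //; apply: leq_trans hr _; rewrite horner_nat.
have : (0 < (input_size A b uq + 3) ^ 16)%N by rewrite expn_gt0 addn3.
lia.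
Qed.
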